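(* For real $\nu>-1$ and $x>0$ let $I_\nu$ denote the modified Bessel function of the first kind, and set $$\Phi_{\nu}(x)=e^{-x}x^{-\nu}\left[I_{\nu}(x)+I_{\nu+1}(x)\right],\qquad \Psi_\nu(x)=\sqrt{\pi}\,2^{\nu}\,\Gamma\!\left(\nu+\tfrac12\right)\Phi_\nu(x)\ \ (\nu>-\tfrac12).$$ Then for each fixed $x>0$: the function $\nu\mapsto\Phi_\nu(x)$ is log-concave on $(-1,\infty)$, and the function $\nu\mapsto\Psi_\nu(x)$ is completely monotonic and log-convex on $\left(-\tfrac12,\infty\right)$. Moreover, for all $\nu>\tfrac12$ and $x>0$ the Turán type inequality $$0<\left[\Phi_{\nu}(x)\right]^2-\Phi_{\nu-1}(x)\Phi_{\nu+1}(x)\le\frac{1}{\nu+\frac{1}{2}}\left[\Phi_{\nu}(x)\right]^2$$ holds, and the left-hand inequality $\left[\Phi_{\nu}(x)\right]^2-\Phi_{\nu-1}(x)\Phi_{\nu+1}(x)>0$ holds for all $\nu>-1$ and $x>0$.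
   Context: A function $f$ on an interval $J$ is completely monotonic if it has derivatives of all orders and $(-1)^m f^{(m)}\ge 0$ on $J$ for all $m\in\{0,1,2,\dots\}$. A positive function is log-convex (log-concave) if its natural logarithm is convex (concave). *)

(* Defs.v *)
From Stdlib Require Import Reals Factorial.
From Coquelicot Require Import Coquelicot.
Open Scope R_scope.

Definition Gamma_pos (s : R) : R :=
  RInt_gen (fun t => Rpower t (s - 1) * exp (- t))
           (at_right 0) (Rbar_locally p_infty).

(* Reciprocal Gamma function 1/Gamma(s) on all of R (entire; zero at the
   poles 0,-1,-2,...), via 1/Gamma(s) = s(s+1)...(s+N-1) / Gamma(s+N)
   for any N with s + N > 0. *)
Definition rgamma_N (s : R) : nat := Z.to_nat (up (Rabs s)).
Fixpoint rising (s : R) (n : nat) : R :=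
  match n with O => 1 | S k => rising s k * (s + INR k) end.
Definition rgamma (s : R) : R :=
  rising s (rgamma_N s) / Gamma_pos (s + INR (rgamma_N s)).

Definition besselI (nu x : R) : R :=
  Series (fun k => Rpower (x / 2) (2 * INR k + nu)
                   * rgamma (INR k + nu + 1) / INR (fact k)).

Definition Phi (nu x : R) : R :=
  exp (- x) * Rpower x (- nu) * (besselI nu x + besselI (nu + 1) x).

Definition Psi (nu x : R) : R :=
  sqrt PI * Rpower 2 nu * Gamma_pos (nu + / 2) * Phi nu x.

Definition log_concave_on (J : R -> Prop) (f : R -> R) : Prop :=
  (forall y, J y -> 0 < f y) /\
  (forall a b t, J a -> J b -> 0 <= t <= 1 ->
     t * ln (f a) + (1 - t) * ln (f b) <= ln (f (t * a + (1 - t) * b))).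

Definition log_convex_on (J : R -> Prop) (f : R -> R) : Prop :=
  (forall y, J y -> 0 < f y) /\
  (forall a b t, J a -> J b -> 0 <= t <= 1 ->
     ln (f (t * a + (1 - t) * b)) <= t * ln (f a) + (1 - t) * ln (f b)).

Definition completely_monotonic_on (J : R -> Prop) (f : R -> R) : Prop :=
  forall (m : nat) y, J y -> ex_derive_n f m y /\ 0 <= (-1) ^ m * Derive_n f m y.

(* Main.v *)
(* With z = x/2 one has Phi_nu(x) = e^(-x) 2^(-nu) F(nu), where
   F(nu) = A(nu) + z A(nu+1) and A(nu) = sum_k z^(2k) / (k! Gamma(k+nu+1)).
   By Vandermonde's identity the Cauchy product F(a) F(b) is a series of terms
   K / (Gamma(a+j) Gamma(b+j)) whose coefficients K > 0 depend only on a + b.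
   Hence log-concavity of F follows termwise from log-convexity of Gamma, and
   the strict Turan inequality from Gamma(s+1) = s Gamma(s).

   For Psi, the terms Gamma(nu+1/2) / Gamma(nu+k+1) are products of factors
   1/(nu+j) and of Gamma(nu+1/2) / Gamma(nu+1), which by Gauss is a limit of
   products of factors 1 + (1/2)/(nu+1/2+j).  Completely monotonic log-convex
   functions are closed under sums, products and pointwise limits, so no
   integral representation of Psi is needed.  The upper Turan bound is midpoint
   log-convexity of Psi between nu-1 and nu+1. *)
Require Import Defs.
From Stdlib Require Import ZArith Reals Lra Lia Psatz Factorial.
From Coquelicot Require Import Coquelicot.
Open Scope R_scope.

(** * The Gamma integral *)

(** Two obstacles shape the proof. The strict Turan inequality for [nu] near [-1] involves the order
    [nu - 1] in [(-2, -1]], where [rgamma nu] can be zero or negative and log-convexity of Gamma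
    says nothing. The product formula is therefore set up for orders above [-2], with only the sum
    of the two orders controlling the signs of its coefficients. The other obstacle is regularity in
    [nu]: neither continuity nor differentiability of Gamma is ever established. From the integral
    come only positivity, the recurrence, the midpoint inequality and a crude local bound. Convexity
    is carried as a midpoint inequality, which survives limits, and becomes full convexity once a
    local bound is known. Smoothness of [Psi] is likewise inherited from rational functions of [nu]:
    a completely monotone function controls its own derivatives by its values further left, so
    pointwise convergence alone carries all derivatives to the limit. *)

Definition gamma_density (s t : R) : R := Rpower t (s - 1) * exp (- t).

Lemma exp_nondecreasing (u v : R) : u <= v -> exp u <= exp v.
Proof. intros [H|<-]; [left; now apply exp_increasing|right; reflexivity]. Qed.

Lemma exp_le_one (u : R) : u <= 0 -> exp u <= 1.
Proof. intros Hu. rewrite <- exp_0. now apply exp_nondecreasing. Qed.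

Lemma ln_le_sub_one (y : R) : 0 < y -> ln y <= y - 1.
Proof.
  intros Hy. pose proof (exp_ineq1_le (ln y)) as H. rewrite exp_ln in H; lra.
Qed.

Lemma is_derive_Rpower (y t : R) :
  0 < t -> is_derive (fun u => Rpower u y) t (y * Rpower t (y - 1)).
Proof. intros Ht. apply is_derive_Reals, derivable_pt_lim_power, Ht. Qed.

Lemma continuous_Rpower (y t : R) :
  0 < t -> continuous (fun u => Rpower u y) t.
Proof.
  intros Ht. apply (ex_derive_continuous (V := R_NormedModule)). eexists. apply is_derive_Rpower, Ht.
Qed.

Lemma continuous_gamma_density (s t : R) :
  0 < t -> continuous (gamma_density s) t.
Proof.
  intros Ht. apply (continuous_mult (K := R_AbsRing)).
  - apply continuous_Rpower, Ht.
  - apply (ex_derive_continuous (V := R_NormedModule)). auto_derive. exact I.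
Qed.

Lemma gamma_density_pos (s t : R) : 0 < gamma_density s t.
Proof. apply Rmult_lt_0_compat; apply exp_pos. Qed.

Lemma ex_RInt_gamma_density (s a b : R) :
  0 < a -> 0 < b -> ex_RInt (gamma_density s) a b.
Proof.
  intros Ha Hb. apply (ex_RInt_continuous (V := R_CompleteNormedModule)). intros z [Hz _].
  apply continuous_gamma_density.
  apply Rlt_le_trans with (2 := Hz). apply Rmin_glb_lt; assumption.
Qed.

Lemma RInt_scal_R (f : R -> R) (k a b : R) :
  ex_RInt f a b -> RInt (fun t => k * f t) a b = k * RInt f a b.
Proof. exact (RInt_scal (V := R_CompleteNormedModule) f a b k). Qed.

Lemma ex_RInt_scal_R (f : R -> R) (k a b : R) :
  ex_RInt f a b -> ex_RInt (fun t => k * f t) a b.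
Proof. exact (ex_RInt_scal (V := R_NormedModule) f a b k). Qed.

(** The maximum of [(1+t)^(s+1) e^(-t)], attained at [t = s]. *)
Definition gamma_bound (s : R) : R := exp ((s + 1) * ln (s + 1) - s).

(* The dominating function [t^(s-1) / (1+t)^(s+1)] has the bounded
   antiderivative [(t / (1+t))^s / s]. *)
Lemma gamma_density_le (s t : R) :
  0 < s -> 0 < t ->
  gamma_density s t
  <= gamma_bound s * (exp (s * (ln t - ln (1 + t))) * (/ t - / (1 + t))).
Proof.
  intros Hs Ht.
  replace (/ t - / (1 + t)) with (exp (- ln t) * exp (- ln (1 + t))).
  2:{ rewrite !exp_Ropp, !exp_ln by lra. field. lra. }
  unfold gamma_density, gamma_bound, Rpower. rewrite <- !exp_plus.
  apply exp_nondecreasing.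
  assert (H : ln ((1 + t) / (s + 1)) <= (1 + t) / (s + 1) - 1).
  { apply ln_le_sub_one. apply Rdiv_lt_0_compat; lra. }
  rewrite ln_div in H by lra.
  assert (H2 : (s + 1) * (ln (1 + t) - ln (s + 1)) <= (s + 1) * ((1 + t) / (s + 1) - 1)).
  { apply Rmult_le_compat_l; lra. }
  replace ((s + 1) * ((1 + t) / (s + 1) - 1)) with (t - s) in H2 by (field; lra).
  nra.
Qed.

Lemma RInt_gamma_density_bounded (s a b : R) :
  0 < s -> 0 < a <= b -> RInt (gamma_density s) a b <= gamma_bound s * / s.
Proof.
  intros Hs Hab.
  set (G := fun t => exp (s * (ln t - ln (1 + t))) / s).
  set (dG := fun t => exp (s * (ln t - ln (1 + t))) * (/ t - / (1 + t))).
  assert (HG : is_RInt dG a b (G b - G a)).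
  { apply (is_RInt_derive (V := R_CompleteNormedModule));
      rewrite Rmin_left, Rmax_right by lra; intros t Ht.
    - unfold G, dG. auto_derive; [lra|]. unfold Rminus, one; simpl. field. lra.
    - apply (ex_derive_continuous (V := R_NormedModule)). unfold dG. auto_derive. lra. }
  apply Rle_trans with (RInt (fun t => gamma_bound s * dG t) a b).
  - apply RInt_le; [lra|apply ex_RInt_gamma_density; lra| |].
    + apply ex_RInt_scal_R. eexists; exact HG.
    + intros t Ht. apply gamma_density_le; lra.
  - rewrite RInt_scal_R by (eexists; exact HG).
    rewrite (is_RInt_unique _ _ _ _ HG).
    apply Rmult_le_compat_l; [left; apply exp_pos|].
    assert (0 < G a) by (apply Rdiv_lt_0_compat; [apply exp_pos|lra]).
    assert (G b <= / s); [|lra].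
    unfold G, Rdiv. rewrite <- (Rmult_1_l (/ s)) at 2.
    apply Rmult_le_compat_r; [left; apply Rinv_0_lt_compat; lra|].
    apply exp_le_one.
    assert (ln b < ln (1 + b)) by (apply ln_increasing; lra). nra.
Qed.

Lemma RInt_gamma_density_mono (s a b a' b' : R) :
  0 < a' -> a' <= a <= b -> b <= b' ->
  RInt (gamma_density s) a b <= RInt (gamma_density s) a' b'.
Proof.
  intros Ha' Hab Hb'.
  rewrite <- (RInt_Chasles _ a' a b') by (apply ex_RInt_gamma_density; lra).
  rewrite <- (RInt_Chasles _ a b b') by (apply ex_RInt_gamma_density; lra).
  assert (0 <= RInt (gamma_density s) a' a).
  { apply RInt_ge_0; [lra|apply ex_RInt_gamma_density; lra|].
    intros; left; apply gamma_density_pos. }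
  assert (0 <= RInt (gamma_density s) b b').
  { apply RInt_ge_0; [lra|apply ex_RInt_gamma_density; lra|].
    intros; left; apply gamma_density_pos. }
  unfold plus; simpl. lra.
Qed.

(* The density being positive, the improper integral is a supremum. *)
Lemma Gamma_pos_lub (s : R) :
  0 < s ->
  is_lub (fun v => exists a b, 0 < a <= b /\ v = RInt (gamma_density s) a b)
         (Gamma_pos s).
Proof.
  intros Hs.
  destruct (completeness
    (fun v => exists a b, 0 < a <= b /\ v = RInt (gamma_density s) a b))
    as [l Hl].
  - exists (gamma_bound s * / s). intros v (a & b & Hab & ->).
    now apply RInt_gamma_density_bounded.
  - exists (RInt (gamma_density s) 1 1), 1, 1. split; [lra|reflexivity].
  - replace (Gamma_pos s) with l; [exact Hl|symmetry].
    apply (is_RInt_gen_unique (gamma_density s)).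
    apply filterlimi_locally. intros [eps Heps].
    destruct Hl as [Hub Hleast].
    (* One interval with integral above [l - eps] suffices: every larger interval has its integral
       between that value and [l]. *)
    assert (Hex : exists a b, 0 < a <= b /\ l - eps < RInt (gamma_density s) a b).
    { destruct (Classical_Prop.classic
        (exists a b, 0 < a <= b /\ l - eps < RInt (gamma_density s) a b))
        as [H|H]; [exact H|exfalso].
      assert (l <= l - eps); [|lra].
      apply Hleast. intros v (a & b & Hab & ->).
      apply Rnot_lt_le. intros Hlt. apply H. now exists a, b. }
    destruct Hex as (a & b & Hab & Hv).
    exists (fun u => 0 < u < a) (fun u => b < u).
    + exists (mkposreal a (proj1 Hab)). intros y Hy Hy0.
      apply Rabs_lt_between' in Hy. simpl in Hy. split; lra.
    + exists b. auto.
    + intros u v Hu Hv'. simpl.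
      exists (RInt (gamma_density s) u v). split.
      * apply RInt_correct, ex_RInt_gamma_density; lra.
      * apply Rabs_lt_between'.
        assert (RInt (gamma_density s) a b <= RInt (gamma_density s) u v)
          by (apply RInt_gamma_density_mono; lra).
        assert (RInt (gamma_density s) u v <= l)
          by (apply Hub; exists u, v; split; [lra|reflexivity]).
        simpl. lra.
Qed.

Lemma RInt_le_Gamma_pos (s a b : R) :
  0 < s -> 0 < a <= b -> RInt (gamma_density s) a b <= Gamma_pos s.
Proof.
  intros Hs Hab. apply (proj1 (Gamma_pos_lub s Hs)). now exists a, b.
Qed.

Lemma Gamma_pos_le (s M : R) :
  0 < s -> (forall a b, 0 < a <= b -> RInt (gamma_density s) a b <= M) ->
  Gamma_pos s <= M.
Proof.
  intros Hs HM. apply (proj2 (Gamma_pos_lub s Hs)).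
  intros v (a & b & Hab & ->). now apply HM.
Qed.

Lemma Gamma_pos_gt0 (s : R) : 0 < s -> 0 < Gamma_pos s.
Proof.
  intros Hs. apply Rlt_le_trans with (2 := RInt_le_Gamma_pos s 1 2 Hs ltac:(lra)).
  apply RInt_gt_0; [lra| |].
  - intros; apply gamma_density_pos.
  - intros; apply continuous_gamma_density; lra.
Qed.

(** Reduces inequalities between Gamma values to pointwise inequalities between integrands. *)
Lemma Gamma_pos_le_combination (a b c k1 k2 : R) :
  0 < a -> 0 < b -> 0 < c -> 0 <= k1 -> 0 <= k2 ->
  (forall t, 0 < t ->
     gamma_density c t <= k1 * gamma_density a t + k2 * gamma_density b t) ->
  Gamma_pos c <= k1 * Gamma_pos a + k2 * Gamma_pos b.
Proof.
  intros Ha Hb Hc Hk1 Hk2 H. apply Gamma_pos_le; [exact Hc|].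
  intros u v Huv.
  assert (Ea := ex_RInt_gamma_density a u v ltac:(lra) ltac:(lra)).
  assert (Eb := ex_RInt_gamma_density b u v ltac:(lra) ltac:(lra)).
  apply Rle_trans with
    (RInt (fun t => k1 * gamma_density a t + k2 * gamma_density b t) u v).
  - apply RInt_le; [lra|apply ex_RInt_gamma_density; lra| |].
    + apply (ex_RInt_plus (V := R_NormedModule)
        (fun t => k1 * gamma_density a t) (fun t => k2 * gamma_density b t));
        apply ex_RInt_scal_R; assumption.
    + intros t Ht. apply H. lra.
  - rewrite (RInt_plus (V := R_CompleteNormedModule)
              (fun t => k1 * gamma_density a t) (fun t => k2 * gamma_density b t))
      by (apply ex_RInt_scal_R; assumption).
    rewrite !RInt_scal_R by assumption.
    apply Rplus_le_compat; apply Rmult_le_compat_l; try assumption;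
      apply RInt_le_Gamma_pos; lra.
Qed.

(** For [t >= 1] the power [t^(c-1)] is below [t^(b-1)], for [t <= 1] below [t^(a-1)]. This is the
    local bound on Gamma that stands in for continuity. *)
Lemma Gamma_pos_le_sum (a b c : R) :
  0 < a -> a <= c <= b -> Gamma_pos c <= Gamma_pos a + Gamma_pos b.
Proof.
  intros Ha Hc.
  replace (Gamma_pos a + Gamma_pos b) with (1 * Gamma_pos a + 1 * Gamma_pos b) by ring.
  apply Gamma_pos_le_combination; try lra.
  intros t Ht.
  replace (1 * gamma_density a t + 1 * gamma_density b t)
    with ((Rpower t (a - 1) + Rpower t (b - 1)) * exp (- t))
    by (unfold gamma_density; ring).
  apply Rmult_le_compat_r; [left; apply exp_pos|].
  unfold Rpower.
  pose proof (exp_pos ((a - 1) * ln t)). pose proof (exp_pos ((b - 1) * ln t)).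
  destruct (Rle_dec 0 (ln t)).
  - assert (exp ((c - 1) * ln t) <= exp ((b - 1) * ln t)) by (apply exp_nondecreasing; nra). lra.
  - assert (exp ((c - 1) * ln t) <= exp ((a - 1) * ln t)) by (apply exp_nondecreasing; nra). lra.
Qed.

(** Cauchy-Schwarz for the integrals, obtained pointwise from [(q u - p v)^2 >= 0]. The weights
    [q/(2p)] and [p/(2q)] are those for which the integrated bound equals [p q]. *)
Lemma Gamma_pos_midpoint (a b : R) :
  0 < a -> 0 < b -> Gamma_pos ((a + b) / 2) ^ 2 <= Gamma_pos a * Gamma_pos b.
Proof.
  intros Ha Hb.
  pose proof (Gamma_pos_gt0 a Ha) as Ga. pose proof (Gamma_pos_gt0 b Hb) as Gb.
  pose proof (Gamma_pos_gt0 ((a + b) / 2) ltac:(lra)) as Gc.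
  set (p := sqrt (Gamma_pos a)). set (q := sqrt (Gamma_pos b)).
  assert (Hp : 0 < p) by (apply sqrt_lt_R0, Ga).
  assert (Hq : 0 < q) by (apply sqrt_lt_R0, Gb).
  assert (Ep : p * p = Gamma_pos a) by (apply sqrt_sqrt; lra).
  assert (Eq : q * q = Gamma_pos b) by (apply sqrt_sqrt; lra).
  assert (H : Gamma_pos ((a + b) / 2)
              <= q / (2 * p) * Gamma_pos a + p / (2 * q) * Gamma_pos b).
  { apply Gamma_pos_le_combination; try lra.
    - left; apply Rdiv_lt_0_compat; lra.
    - left; apply Rdiv_lt_0_compat; lra.
    - intros t Ht.
      replace (q / (2 * p) * gamma_density a t + p / (2 * q) * gamma_density b t)
        with ((q / (2 * p) * Rpower t (a - 1) + p / (2 * q) * Rpower t (b - 1)) * exp (- t))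
        by (unfold gamma_density; ring).
      apply Rmult_le_compat_r; [left; apply exp_pos|].
      unfold Rpower.
      set (u := exp ((a - 1) / 2 * ln t)). set (v := exp ((b - 1) / 2 * ln t)).
      replace (exp (((a + b) / 2 - 1) * ln t)) with (u * v)
        by (unfold u, v; rewrite <- exp_plus; f_equal; field).
      replace (exp ((a - 1) * ln t)) with (u * u)
        by (unfold u; rewrite <- exp_plus; f_equal; field).
      replace (exp ((b - 1) * ln t)) with (v * v)
        by (unfold v; rewrite <- exp_plus; f_equal; field).
      apply Rminus_le.
      replace (u * v - (q / (2 * p) * (u * u) + p / (2 * q) * (v * v)))
        with (- ((q * u - p * v) ^ 2 / (2 * p * q))) by (field; lra).
      assert (0 <= (q * u - p * v) ^ 2 / (2 * p * q)); [|lra].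
      apply Rdiv_le_0_compat; [apply pow2_ge_0|]. nra. }
  rewrite <- Ep, <- Eq in H |- *.
  replace (q / (2 * p) * (p * p) + p / (2 * q) * (q * q)) with (p * q) in H by (field; lra).
  replace (p * p * (q * q)) with ((p * q) ^ 2) by ring.
  apply pow_incr. lra.
Qed.

(** Integration by parts; the boundary term [t^s e^(-t)] is itself [gamma_density (s + 1)]. *)
Lemma RInt_gamma_density_succ (s a b : R) :
  0 < a <= b ->
  RInt (gamma_density (s + 1)) a b
  = s * RInt (gamma_density s) a b + gamma_density (s + 1) a - gamma_density (s + 1) b.
Proof.
  intros Hab.
  assert (Ea := ex_RInt_gamma_density s a b ltac:(lra) ltac:(lra)).
  assert (Eb := ex_RInt_gamma_density (s + 1) a b ltac:(lra) ltac:(lra)).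
  assert (H : is_RInt (fun t => s * gamma_density s t - gamma_density (s + 1) t)
     a b (gamma_density (s + 1) b - gamma_density (s + 1) a)).
  { apply (is_RInt_derive (V := R_CompleteNormedModule));
      rewrite Rmin_left, Rmax_right by lra; intros t Ht.
    - unfold gamma_density.
      replace (s * (Rpower t (s - 1) * exp (- t)) - Rpower t (s + 1 - 1) * exp (- t))
        with (s * Rpower t (s - 1) * exp (- t) + Rpower t s * (- exp (- t)))
        by (replace (s + 1 - 1) with s by ring; ring).
      replace (s + 1 - 1) with s by ring.
      refine (is_derive_mult (K := R_AbsRing) (fun u => Rpower u s) (fun u => exp (- u))
        t _ _ (is_derive_Rpower s t ltac:(lra)) _ Rmult_comm).
      auto_derive; [exact I|ring].
    - apply (continuous_minus (V := R_NormedModule)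
        (fun u => s * gamma_density s u) (gamma_density (s + 1))).
      + apply (continuous_scal_r (V := R_NormedModule) s (gamma_density s)).
        apply continuous_gamma_density; lra.
      + apply continuous_gamma_density; lra. }
  apply (is_RInt_unique (V := R_CompleteNormedModule)) in H.
  rewrite (RInt_minus (V := R_CompleteNormedModule)
    (fun t => s * gamma_density s t) (gamma_density (s + 1))) in H
    by (try apply ex_RInt_scal_R; assumption).
  rewrite RInt_scal_R in H by exact Ea.
  unfold minus, plus, opp in H; simpl in H. lra.
Qed.

Lemma gamma_density_small_left (s eps : R) :
  0 < s -> 0 < eps -> exists d, 0 < d /\ forall t, 0 < t <= d -> gamma_density (s + 1) t <= eps.
Proof.
  intros Hs He. exists (Rpower eps (/ s)). split; [apply exp_pos|].
  intros t Ht. unfold gamma_density. replace (s + 1 - 1) with s by ring.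
  rewrite <- (Rmult_1_r eps).
  apply Rmult_le_compat; try (left; apply exp_pos).
  - replace eps with (Rpower (Rpower eps (/ s)) s).
    + apply Rle_Rpower_l; lra.
    + rewrite Rpower_mult, Rinv_l, Rpower_1; lra.
  - apply exp_le_one. lra.
Qed.

Lemma gamma_density_small_right (s eps : R) :
  0 < s -> 0 < eps -> exists d, forall t, d <= t -> gamma_density (s + 1) t <= eps.
Proof.
  intros Hs He. set (C := gamma_bound (s + 1)).
  assert (HC : 0 < C) by apply exp_pos.
  exists (1 + C / eps). intros t Ht.
  assert (0 < C / eps) by (apply Rdiv_lt_0_compat; lra).
  apply Rle_trans with (C * / t).
  - apply Rle_trans with (1 := gamma_density_le (s + 1) t ltac:(lra) ltac:(lra)).
    apply Rmult_le_compat_l; [lra|].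
    assert (0 < / (1 + t)) by (apply Rinv_0_lt_compat; lra).
    assert (/ (1 + t) < / t) by (apply Rinv_lt_contravar; nra).
    assert (exp ((s + 1) * (ln t - ln (1 + t))) <= 1).
    { apply exp_le_one.
      assert (ln t < ln (1 + t)) by (apply ln_increasing; lra). nra. }
    pose proof (exp_pos ((s + 1) * (ln t - ln (1 + t)))). nra.
  - apply Rmult_le_reg_r with t; [lra|].
    rewrite Rmult_assoc, Rinv_l, Rmult_1_r by lra.
    replace C with (eps * (C / eps)) by (field; lra).
    apply Rmult_le_compat_l; lra.
Qed.

(** With Gamma as a supremum, each inequality has to remove only one boundary term, by enlarging the
    interval on that side; the other boundary term has the favourable sign. *)
Lemma Gamma_pos_succ (s : R) : 0 < s -> Gamma_pos (s + 1) = s * Gamma_pos s.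
Proof.
  intros Hs. apply Rle_antisym.
  - apply Gamma_pos_le; [lra|]. intros a b Hab.
    apply le_epsilon. intros eps He.
    destruct (gamma_density_small_left s eps Hs He) as (d & Hd & Hsmall).
    set (a' := Rmin a d).
    assert (Ha' : 0 < a' <= a /\ a' <= d)
      by (unfold a', Rmin; destruct (Rle_dec a d); lra).
    apply Rle_trans with (1 := RInt_gamma_density_mono (s + 1) a b a' b
      ltac:(lra) ltac:(lra) ltac:(lra)).
    rewrite RInt_gamma_density_succ by lra.
    pose proof (Hsmall a' ltac:(lra)). pose proof (gamma_density_pos (s + 1) b).
    pose proof (RInt_le_Gamma_pos s a' b Hs ltac:(lra)). nra.
  - apply Rmult_le_reg_l with (/ s); [apply Rinv_0_lt_compat, Hs|].
    rewrite <- Rmult_assoc, Rinv_l, Rmult_1_l by lra.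
    apply Gamma_pos_le; [lra|]. intros a b Hab.
    apply Rmult_le_reg_l with s; [exact Hs|].
    rewrite <- Rmult_assoc, Rinv_r, Rmult_1_l by lra.
    apply le_epsilon. intros eps He.
    destruct (gamma_density_small_right s eps Hs He) as (d & Hsmall).
    set (b' := Rmax b d).
    pose proof (Rmax_l b d). pose proof (Rmax_r b d).
    apply Rle_trans with (s * RInt (gamma_density s) a b').
    + apply Rmult_le_compat_l; [lra|]. apply RInt_gamma_density_mono; unfold b'; lra.
    + pose proof (RInt_gamma_density_succ s a b' ltac:(unfold b'; lra)).
      pose proof (Hsmall b' ltac:(unfold b'; lra)).
      pose proof (gamma_density_pos (s + 1) a).
      pose proof (RInt_le_Gamma_pos (s + 1) a b' ltac:(lra) ltac:(unfold b'; lra)). lra.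
Qed.

(** * Product formula for the Bessel series *)

Lemma rising_div_Gamma_pos (s : R) (n d : nat) :
  0 < s + INR n ->
  rising s (n + d) / Gamma_pos (s + INR (n + d)) = rising s n / Gamma_pos (s + INR n).
Proof.
  intros Hn. induction d as [|d IH].
  - now rewrite Nat.add_0_r.
  - rewrite <- IH, Nat.add_succ_r, S_INR. simpl rising.
    pose proof (pos_INR d). rewrite plus_INR in *.
    pose proof (Gamma_pos_gt0 (s + (INR n + INR d)) ltac:(lra)).
    replace (s + (INR n + INR d + 1)) with (s + (INR n + INR d) + 1) by ring.
    rewrite Gamma_pos_succ by lra.
    field. split; lra.
Qed.

(** Any admissible shift gives the same value: the shifts [n] and [N] both agree with [N + n]. *)
Lemma rgamma_eq (s : R) (n : nat) :
  0 < s + INR n -> rgamma s = rising s n / Gamma_pos (s + INR n).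
Proof.
  intros Hn. unfold rgamma.
  assert (HN : 0 < s + INR (rgamma_N s)).
  { unfold rgamma_N. destruct (archimed (Rabs s)) as [Hup _].
    pose proof (Rabs_pos s). pose proof (Rle_abs (- s)) as Habs.
    rewrite Rabs_Ropp in Habs.
    rewrite INR_IZR_INZ, Z2Nat.id; [lra|].
    apply le_IZR. lra. }
  set (N := rgamma_N s) in *.
  rewrite <- (rising_div_Gamma_pos s N n HN), <- (rising_div_Gamma_pos s n N Hn).
  now rewrite Nat.add_comm.
Qed.

Lemma rgamma_pos_arg (s : R) : 0 < s -> rgamma s = / Gamma_pos s.
Proof.
  intros Hs. rewrite (rgamma_eq s 0) by (simpl; lra). simpl. rewrite Rplus_0_r.
  unfold Rdiv. ring.
Qed.

Lemma rgamma_gt0 (s : R) : 0 < s -> 0 < rgamma s.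
Proof.
  intros Hs. rewrite rgamma_pos_arg by exact Hs.
  apply Rinv_0_lt_compat, Gamma_pos_gt0, Hs.
Qed.

Lemma rising_succ_l (s : R) (n : nat) : rising s (S n) = s * rising (s + 1) n.
Proof.
  induction n as [|n IH].
  - simpl. ring.
  - change (rising s (S (S n))) with (rising s (S n) * (s + INR (S n))).
    rewrite IH, S_INR. simpl. ring.
Qed.

(** Valid for every real [s], poles of Gamma included, which is what orders below [-1] require. *)
Lemma rgamma_succ (s : R) : rgamma s = s * rgamma (s + 1).
Proof.
  destruct (INR_unbounded (- s)) as [n Hn].
  rewrite (rgamma_eq s (S n)), (rgamma_eq (s + 1) n) by (try rewrite S_INR; lra).
  rewrite rising_succ_l, S_INR.
  replace (s + (INR n + 1)) with (s + 1 + INR n) by ring.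
  unfold Rdiv. ring.
Qed.

(** * Generalized binomial coefficients and Vandermonde's identity *)

Fixpoint falling (p : R) (k : nat) : R :=
  match k with O => 1 | S j => falling p j * (p - INR j) end.

Definition gbinom (p : R) (k : nat) : R := falling p k / INR (fact k).

Lemma gbinom_succ (p : R) (k : nat) :
  INR (S k) * gbinom p (S k) = (p - INR k) * gbinom p k.
Proof.
  unfold gbinom. rewrite fact_simpl, mult_INR. simpl falling.
  field. split; [apply INR_fact_neq_0|apply not_0_INR; discriminate].
Qed.

Lemma falling_pos (p : R) (k : nat) : INR k - 1 < p -> 0 < falling p k.
Proof.
  induction k as [|k IH]; simpl falling; [lra|].
  rewrite S_INR. intros Hp. apply Rmult_lt_0_compat; [apply IH|]; lra.
Qed.

(** Induction after multiplying by [m + 1], split as [(m + 1 - j) + j]. [gbinom_succ] absorbs each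
    part into a lower coefficient, and the resulting factors [p - (m - j)] and [q - j] add up to
    [p + q - m]. *)
Lemma Vandermonde (p q : R) (m : nat) :
  sum_f_R0 (fun j => gbinom p (m - j) * gbinom q j) m = gbinom (p + q) m.
Proof.
  induction m as [|m IH].
  - unfold gbinom. simpl. field.
  - apply Rmult_eq_reg_l with (INR (S m)); [|apply not_0_INR; discriminate].
    rewrite gbinom_succ, <- IH, !scal_sum.
    transitivity
      (sum_f_R0 (fun j => INR (S m - j) * gbinom p (S m - j) * gbinom q j) (S m)
       + sum_f_R0 (fun j => gbinom p (S m - j) * (INR j * gbinom q j)) (S m)).
    { rewrite <- plus_sum. apply sum_eq. intros j Hj.
      rewrite (minus_INR (S m) j) by exact Hj. ring. }
    rewrite (tech5 (fun j => INR (S m - j) * gbinom p (S m - j) * gbinom q j) m).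
    rewrite (decomp_sum (fun j => gbinom p (S m - j) * (INR j * gbinom q j))) by lia.
    rewrite Nat.sub_diag. simpl (INR 0). simpl pred.
    rewrite !Rmult_0_l, !Rmult_0_r, Rplus_0_r, Rplus_0_l, <- plus_sum.
    apply sum_eq. intros j Hj.
    rewrite Nat.sub_succ_l, !gbinom_succ by exact Hj.
    simpl (S m - S j)%nat. rewrite minus_INR by exact Hj. ring.
Qed.

Lemma rgamma_falling (s : R) (k : nat) :
  rgamma (s + 1 - INR k) = falling s k * rgamma (s + 1).
Proof.
  induction k as [|k IH].
  - simpl. rewrite Rmult_1_l. f_equal. ring.
  - rewrite rgamma_succ, S_INR.
    replace (s + 1 - (INR k + 1) + 1) with (s + 1 - INR k) by ring.
    rewrite IH. simpl. ring.
Qed.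

Definition bessel_coef (nu : R) (k : nat) : R := rgamma (INR k + nu + 1) / INR (fact k).

(** All reciprocal Gamma factors are pulled down from the top index [m] by [rgamma_falling]. What
    remains under the sum is Vandermonde with upper arguments [m + a] and [m + b]. *)
Lemma bessel_coef_convolution (a b : R) (m : nat) :
  sum_f_R0 (fun j => bessel_coef a j * bessel_coef b (m - j)) m
  = gbinom (a + b + 2 * INR m) m * (rgamma (INR m + a + 1) * rgamma (INR m + b + 1)).
Proof.
  replace (a + b + 2 * INR m) with ((INR m + a) + (INR m + b)) by ring.
  rewrite <- Vandermonde, Rmult_comm, scal_sum.
  apply sum_eq. intros j Hj. unfold bessel_coef, gbinom.
  replace (INR j + a + 1) with (INR m + a + 1 - INR (m - j))
    by (rewrite minus_INR by exact Hj; ring).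
  replace (INR (m - j) + b + 1) with (INR m + b + 1 - INR j)
    by (rewrite minus_INR by exact Hj; ring).
  rewrite !rgamma_falling. field. split; apply INR_fact_neq_0.
Qed.

(** From the argument [nu + 3 > 1] on, the recurrence makes [rgamma] decrease along unit steps; the
    two earlier values are counted separately, as the first may be negative. *)
Lemma rgamma_bounded (nu : R) :
  -2 < nu -> exists M, forall k, Rabs (rgamma (INR k + nu + 1)) <= M.
Proof.
  intros Hnu.
  exists (Rabs (rgamma (nu + 1)) + Rabs (rgamma (nu + 2)) + rgamma (nu + 3)).
  pose proof (Rabs_pos (rgamma (nu + 1))). pose proof (Rabs_pos (rgamma (nu + 2))).
  pose proof (rgamma_gt0 (nu + 3) ltac:(lra)).
  assert (Hdec : forall k, rgamma (INR k + nu + 3) <= rgamma (nu + 3)).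
  { induction k as [|k IH].
    - simpl. rewrite Rplus_0_l. lra.
    - apply Rle_trans with (2 := IH). pose proof (pos_INR k).
      rewrite (rgamma_succ (INR k + nu + 3)), S_INR.
      replace (INR k + 1 + nu + 3) with (INR k + nu + 3 + 1) by ring.
      pose proof (rgamma_gt0 (INR k + nu + 3 + 1) ltac:(lra)). nra. }
  intros [|[|k]].
  - replace (INR 0 + nu + 1) with (nu + 1) by (simpl; ring). lra.
  - replace (INR 1 + nu + 1) with (nu + 2) by (simpl; ring). lra.
  - replace (INR (S (S k)) + nu + 1) with (INR k + nu + 3) by (rewrite !S_INR; ring).
    pose proof (pos_INR k).
    rewrite Rabs_pos_eq by (left; apply rgamma_gt0; lra).
    specialize (Hdec k). lra.
Qed.

Lemma ex_series_exp (w : R) : ex_series (fun k => w ^ k / INR (fact k)).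
Proof.
  exists (exp w). apply is_series_ext with (2 := is_exp_Reals w).
  intros n. rewrite pow_n_pow. reflexivity.
Qed.

(** * The Bessel series and its products *)

Definition bessel_term (w nu : R) (k : nat) : R := w ^ k * bessel_coef nu k.
Definition bessel_sum (w nu : R) : R := Series (bessel_term w nu).

Lemma ex_series_bessel_abs (w nu : R) :
  0 <= w -> -2 < nu -> ex_series (fun k => Rabs (bessel_term w nu k)).
Proof.
  intros Hw Hnu. destruct (rgamma_bounded nu Hnu) as [M HM].
  apply (ex_series_le (V := R_CompleteNormedModule)) with (fun k => M * (w ^ k / INR (fact k))).
  - intros k. unfold norm; simpl. unfold abs; simpl. rewrite Rabs_Rabsolu.
    unfold bessel_term, bessel_coef. rewrite Rabs_mult, Rabs_div by apply INR_fact_neq_0.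
    rewrite (Rabs_pos_eq (w ^ k)) by (apply pow_le, Hw).
    rewrite (Rabs_pos_eq (INR (fact k))) by apply pos_INR.
    replace (w ^ k * (Rabs (rgamma (INR k + nu + 1)) / INR (fact k)))
      with (Rabs (rgamma (INR k + nu + 1)) * (w ^ k / INR (fact k)))
      by (field; apply INR_fact_neq_0).
    apply Rmult_le_compat_r; [|apply HM].
    apply Rdiv_le_0_compat; [apply pow_le, Hw|apply INR_fact_lt_0].
  - apply (ex_series_scal (V := R_NormedModule) M (fun k => w ^ k / INR (fact k))).
    apply ex_series_exp.
Qed.

Lemma is_series_bessel (w nu : R) :
  0 <= w -> -2 < nu -> is_series (bessel_term w nu) (bessel_sum w nu).
Proof.
  intros Hw Hnu. apply Series_correct, ex_series_Rabs, ex_series_bessel_abs; assumption.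
Qed.

Lemma is_series_bessel_product (w a b : R) :
  0 <= w -> -2 < a -> -2 < b ->
  is_series (fun m => w ^ m * gbinom (a + b + 2 * INR m) m
                      * (rgamma (INR m + a + 1) * rgamma (INR m + b + 1)))
            (bessel_sum w a * bessel_sum w b).
Proof.
  intros Hw Ha Hb.
  apply is_series_ext with
    (2 := is_series_mult _ _ _ _ (is_series_bessel w a Hw Ha) (is_series_bessel w b Hw Hb)
            (ex_series_bessel_abs w a Hw Ha) (ex_series_bessel_abs w b Hw Hb)).
  intros m. rewrite Rmult_assoc, <- bessel_coef_convolution, scal_sum.
  apply sum_eq. intros j Hj. unfold bessel_term.
  replace (w ^ m) with (w ^ j * w ^ (m - j)) by (rewrite <- pow_add; f_equal; lia).
  ring.
Qed.

(** The [F] of the overview, with [bessel_sum (z ^ 2)] as [A]. *)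
Definition bessel_pair (z nu : R) : R :=
  bessel_sum (z ^ 2) nu + z * bessel_sum (z ^ 2) (nu + 1).

Lemma Phi_bessel_pair (nu x : R) :
  0 < x -> Phi nu x = exp (- x) * Rpower 2 (- nu) * bessel_pair (x / 2) nu.
Proof.
  intros Hx.
  assert (HI : forall mu, besselI mu x = Rpower (x / 2) mu * bessel_sum ((x / 2) ^ 2) mu).
  { intros mu. unfold besselI, bessel_sum. rewrite <- Series_scal_l.
    apply Series_ext. intros k. unfold bessel_term, bessel_coef.
    rewrite <- pow_mult, <- Rpower_pow, Rpower_plus, mult_INR by lra.
    replace (INR 2) with 2 by (simpl; ring). unfold Rdiv. ring. }
  unfold Phi, bessel_pair. rewrite !HI, Rpower_plus, Rpower_1 by lra.
  replace (Rpower 2 (- nu)) with (Rpower x (- nu) * Rpower (x / 2) nu); [ring|].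
  rewrite !Rpower_Ropp.
  replace x with (x / 2 * 2) at 1 by field.
  rewrite <- Rpower_mult_distr by lra.
  field. split; apply Rgt_not_eq, exp_pos.
Qed.

(* In the product of the mixed terms the two reciprocal Gamma factors combine
   through [(m+a+1) + (m+b+1)], which again depends only on [a + b]. *)
Lemma bessel_pair_product (z sigma : R) :
  0 < z -> -2 < sigma ->
  exists K1 K2 : nat -> R,
    (forall m, 0 < K1 m /\ 0 < K2 m) /\
    forall a b, -2 < a -> -2 < b -> a + b = sigma ->
      is_series (fun m => K1 m * (rgamma (INR m + 1 + a) * rgamma (INR m + 1 + b))
                   + K2 m * (rgamma (INR m + 2 + a) * rgamma (INR m + 2 + b)))
                (bessel_pair z a * bessel_pair z b).
Proof.
  intros Hz Hs.
  set (c := fun s m => (z ^ 2) ^ m * gbinom (s + 2 * INR m) m).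
  assert (Hc : forall s m, -2 < s -> 0 < c s m).
  { intros s m Hs'. apply Rmult_lt_0_compat; [apply pow_lt, pow_lt, Hz|].
    apply Rdiv_lt_0_compat; [|apply INR_fact_lt_0].
    (* For [m >= 1] the smallest factor of the falling factorial is [s + m + 1], positive since
       [s > -2]; for [m = 0] the product is empty. *)
    destruct m as [|m]; [simpl; lra|].
    apply falling_pos. rewrite S_INR. pose proof (pos_INR m). lra. }
  exists (c sigma), (fun m => z * c (sigma + 1) m * (sigma + 2 * INR m + 2)
                              + z ^ 2 * c (sigma + 2) m).
  split.
  - intros m. split; [now apply Hc|].
    pose proof (Hc (sigma + 1) m ltac:(lra)). pose proof (Hc (sigma + 2) m ltac:(lra)).
    pose proof (pos_INR m).
    pose proof (pow_lt z 2 Hz).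
    apply Rplus_lt_0_compat; [|now apply Rmult_lt_0_compat].
    apply Rmult_lt_0_compat; [now apply Rmult_lt_0_compat|lra].
  - intros a b Ha Hb Hab.
    assert (Hw : 0 <= z ^ 2) by apply pow2_ge_0.
    pose proof (is_series_bessel_product (z ^ 2) a b Hw Ha Hb) as S00.
    pose proof (is_series_bessel_product (z ^ 2) a (b + 1) Hw Ha ltac:(lra)) as S01.
    pose proof (is_series_bessel_product (z ^ 2) (a + 1) b Hw ltac:(lra) Hb) as S10.
    pose proof (is_series_bessel_product (z ^ 2) (a + 1) (b + 1) Hw ltac:(lra) ltac:(lra))
      as S11.
    apply (is_series_scal (V := R_NormedModule) (z ^ 2)) in S11.
    pose proof (is_series_scal (V := R_NormedModule) z _ _
                  (is_series_plus (V := R_NormedModule) _ _ _ _ S01 S10)) as S1.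
    pose proof (is_series_plus (V := R_NormedModule) _ _ _ _ S00
                  (is_series_plus (V := R_NormedModule) _ _ _ _ S1 S11)) as S.
    unfold plus, scal in S; simpl in S. unfold mult in S; simpl in S.
    replace (bessel_pair z a * bessel_pair z b) with
      (bessel_sum (z * (z * 1)) a * bessel_sum (z * (z * 1)) b +
       (z * (bessel_sum (z * (z * 1)) a * bessel_sum (z * (z * 1)) (b + 1) +
             bessel_sum (z * (z * 1)) (a + 1) * bessel_sum (z * (z * 1)) b) +
        z * (z * 1) * (bessel_sum (z * (z * 1)) (a + 1) * bessel_sum (z * (z * 1)) (b + 1))))
      by (unfold bessel_pair; simpl; ring).
    apply is_series_ext with (2 := S).
    intros m. cbv beta. unfold c. simpl pow.
    replace (a + (b + 1)) with (sigma + 1) by lra.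
    replace (a + 1 + b) with (sigma + 1) by lra.
    replace (a + 1 + (b + 1)) with (sigma + 2) by lra.
    rewrite Hab.
    replace (INR m + (a + 1) + 1) with (INR m + 2 + a) by ring.
    replace (INR m + (b + 1) + 1) with (INR m + 2 + b) by ring.
    replace (INR m + a + 1) with (INR m + 1 + a) by ring.
    replace (INR m + b + 1) with (INR m + 1 + b) by ring.
    assert (Ea : rgamma (INR m + 1 + a) = (INR m + 1 + a) * rgamma (INR m + 2 + a)).
    { rewrite (rgamma_succ (INR m + 1 + a)). do 2 f_equal. ring. }
    assert (Eb : rgamma (INR m + 1 + b) = (INR m + 1 + b) * rgamma (INR m + 2 + b)).
    { rewrite (rgamma_succ (INR m + 1 + b)). do 2 f_equal. ring. }
    rewrite Ea, Eb, <- Hab. match goal with |- ?l = ?r => change (l = r :> R) end. ring.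
Qed.

Lemma is_series_ge_head (u : nat -> R) (l : R) :
  is_series u l -> (forall n, 0 <= u n) -> u 0%nat <= l.
Proof.
  intros Hu Hpos.
  replace (u 0%nat) with (sum_n u 0) by apply sum_O.
  apply (is_lim_seq_incr_compare (sum_n u)); [exact Hu|].
  intros n. rewrite sum_Sn. unfold plus; simpl. specialize (Hpos (S n)). lra.
Qed.

(** The coefficients being the same for [(c, c)] and [(a, b)], the two product series differ by a
    series of nonnegative terms, which is at least its first term. Strictness at [s = 1] alone makes
    that term positive. *)
Lemma bessel_pair_mul_le (z a b c : R) :
  0 < z -> -2 < a -> -2 < b -> -1 < c -> a + b = 2 * c ->
  (forall s, 1 <= s -> rgamma (s + a) * rgamma (s + b) <= rgamma (s + c) ^ 2) ->
  bessel_pair z a * bessel_pair z b <= bessel_pair z c ^ 2 /\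
  (rgamma (1 + a) * rgamma (1 + b) < rgamma (1 + c) ^ 2 ->
   bessel_pair z a * bessel_pair z b < bessel_pair z c ^ 2).
Proof.
  intros Hz Ha Hb Hc Hab Hle.
  destruct (bessel_pair_product z (2 * c) Hz ltac:(lra)) as (K1 & K2 & HK & HS).
  pose proof (is_series_minus (V := R_NormedModule) _ _ _ _
    (HS c c ltac:(lra) ltac:(lra) ltac:(lra)) (HS a b Ha Hb Hab)) as S.
  unfold minus, plus, opp in S; simpl in S.
  apply is_series_ge_head in S.
  - pose proof (HK 0%nat) as [HK1 HK2].
    pose proof (Hle 2 ltac:(lra)) as H2. pose proof (Hle 1 ltac:(lra)) as H1.
    simpl in S, H1, H2. simpl pow. rewrite !Rplus_0_l in S.
    replace (1 + 1) with 2 in S by ring. rewrite !Rmult_1_r in *.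
    split; intros; nra.
  - intros n. pose proof (HK n) as [HK1 HK2]. pose proof (pos_INR n).
    pose proof (Hle (INR n + 1) ltac:(lra)) as H1.
    pose proof (Hle (INR n + 2) ltac:(lra)) as H2.
    simpl in H1, H2. rewrite !Rmult_1_r in *.
    assert (0 <= K1 n * (rgamma (INR n + 1 + c) * rgamma (INR n + 1 + c)
               - rgamma (INR n + 1 + a) * rgamma (INR n + 1 + b)))
      by (apply Rmult_le_pos; lra).
    assert (0 <= K2 n * (rgamma (INR n + 2 + c) * rgamma (INR n + 2 + c)
               - rgamma (INR n + 2 + a) * rgamma (INR n + 2 + b)))
      by (apply Rmult_le_pos; lra).
    lra.
Qed.

Lemma bessel_pair_midpoint (z a b : R) :
  0 < z -> -1 < a -> -1 < b ->
  bessel_pair z a * bessel_pair z b <= bessel_pair z ((a + b) / 2) ^ 2.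
Proof.
  intros Hz Ha Hb. apply bessel_pair_mul_le; try lra.
  intros s Hs. rewrite !rgamma_pos_arg by lra.
  replace (s + (a + b) / 2) with ((s + a + (s + b)) / 2) by field.
  pose proof (Gamma_pos_midpoint (s + a) (s + b) ltac:(lra) ltac:(lra)) as H.
  pose proof (Gamma_pos_gt0 ((s + a + (s + b)) / 2) ltac:(lra)).
  rewrite <- Rinv_mult, pow_inv. apply Rinv_le_contravar; [nra|exact H].
Qed.

(** With [g = rgamma (s + nu + 1)] the termwise claim is [(s+nu-1)(s+nu) g^2 < (s+nu)^2 g^2]. Only
    the recurrence enters, so [s + nu - 1] may be negative. *)
Lemma bessel_pair_turan (z nu : R) :
  0 < z -> -1 < nu ->
  bessel_pair z (nu - 1) * bessel_pair z (nu + 1) < bessel_pair z nu ^ 2.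
Proof.
  intros Hz Hnu.
  assert (H : forall s, 1 <= s ->
    rgamma (s + (nu - 1)) * rgamma (s + (nu + 1)) < rgamma (s + nu) ^ 2).
  { intros s Hs. set (g := rgamma (s + (nu + 1))).
    assert (Hg : 0 < g) by (apply rgamma_gt0; lra).
    assert (E1 : rgamma (s + nu) = (s + nu) * g).
    { unfold g. rewrite (rgamma_succ (s + nu)). do 2 f_equal. ring. }
    assert (E2 : rgamma (s + (nu - 1)) = (s + nu - 1) * ((s + nu) * g)).
    { rewrite <- E1, (rgamma_succ (s + (nu - 1))). f_equal; [|f_equal]; ring. }
    rewrite E1, E2.
    assert (0 < (s + nu) * g ^ 2) by (apply Rmult_lt_0_compat; [lra|apply pow_lt, Hg]).
    nra. }
  apply bessel_pair_mul_le; try lra.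
  - intros s Hs. left. now apply H.
  - apply H. lra.
Qed.

(** Keeps only the term [k = 0] of the first sum. It serves for positivity and for a lower bound
    uniform over a bounded range of orders. *)
Lemma bessel_pair_ge (z nu : R) :
  0 < z -> -1 < nu -> rgamma (nu + 1) <= bessel_pair z nu.
Proof.
  intros Hz Hnu.
  assert (H : forall mu, -1 < mu -> rgamma (mu + 1) <= bessel_sum (z ^ 2) mu).
  { intros mu Hmu.
    replace (rgamma (mu + 1)) with (bessel_term (z ^ 2) mu 0).
    - apply is_series_ge_head.
      + apply is_series_bessel; [apply pow2_ge_0|lra].
      + intros n. pose proof (pos_INR n). apply Rmult_le_pos; [apply pow_le, pow2_ge_0|].
        left. apply Rdiv_lt_0_compat; [apply rgamma_gt0; lra|apply INR_fact_lt_0].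
    - unfold bessel_term, bessel_coef. simpl. rewrite Rplus_0_l. field. }
  unfold bessel_pair. pose proof (H nu Hnu). pose proof (H (nu + 1) ltac:(lra)).
  pose proof (rgamma_gt0 (nu + 1 + 1) ltac:(lra)).
  assert (0 <= z * bessel_sum (z ^ 2) (nu + 1)) by (apply Rmult_le_pos; lra).
  lra.
Qed.

(** * Midpoint convexity and complete monotonicity *)

Lemma convex_combination_between (a b t : R) :
  0 <= t <= 1 -> Rmin a b <= t * a + (1 - t) * b <= Rmax a b.
Proof. intros Ht. unfold Rmin, Rmax. destruct (Rle_dec a b); nra. Qed.

(* The defect [D t = ln f(t a + (1-t) b) - t ln f(a) - (1-t) ln f(b)] satisfies
   [D t >= D (2t) / 2] or [D t >= D (2t - 1) / 2], so a lower bound [-M] of [D]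
   improves itself to [-M / 2^n]. *)
Lemma log_concave_of_midpoint (lo : R) (f : R -> R) :
  (forall y, lo < y -> 0 < f y) ->
  (forall a b, lo < a -> lo < b -> f a * f b <= f ((a + b) / 2) ^ 2) ->
  (forall a b, lo < a -> lo < b ->
     exists m, 0 < m /\ forall c, Rmin a b <= c <= Rmax a b -> m <= f c) ->
  log_concave_on (fun y => lo < y) f.
Proof.
  intros Hpos Hmid Hlow. split; [exact Hpos|].
  intros a b t Ha Hb Ht.
  set (D := fun t => ln (f (t * a + (1 - t) * b)) - t * ln (f a) - (1 - t) * ln (f b)).
  assert (Hin : forall s, 0 <= s <= 1 -> lo < s * a + (1 - s) * b) 
    by (intros s Hs; apply Rlt_le_trans with (2 := proj1 (convex_combination_between a b s Hs));
        now apply Rmin_glb_lt).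
  assert (Hln : forall u v, lo < u -> lo < v ->
            ln (f u) + ln (f v) <= 2 * ln (f ((u + v) / 2))).
  { intros u v Hu Hv.
    pose proof (Hpos u Hu). pose proof (Hpos v Hv).
    pose proof (Hpos ((u + v) / 2) ltac:(lra)).
    rewrite <- ln_mult by assumption.
    replace (2 * ln (f ((u + v) / 2))) with (ln (f ((u + v) / 2) ^ 2))
      by (rewrite ln_pow by assumption; simpl; ring).
    apply ln_le; [apply Rmult_lt_0_compat; assumption|now apply Hmid]. }
  assert (Hhalf : forall B, (forall s, 0 <= s <= 1 -> - B <= D s) ->
            forall s, 0 <= s <= 1 -> - (B / 2) <= D s).
  { intros B HB s Hs. destruct (Rle_dec s (1 / 2)) as [Hle|Hgt].
    - pose proof (HB (2 * s) ltac:(lra)) as H.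
      pose proof (Hln _ b (Hin (2 * s) ltac:(lra)) Hb) as H2.
      replace ((2 * s * a + (1 - 2 * s) * b + b) / 2) with (s * a + (1 - s) * b) in H2 by field.
      unfold D in *. lra.
    - pose proof (HB (2 * s - 1) ltac:(lra)) as H.
      pose proof (Hln _ a (Hin (2 * s - 1) ltac:(lra)) Ha) as H2.
      replace (((2 * s - 1) * a + (1 - (2 * s - 1)) * b + a) / 2)
        with (s * a + (1 - s) * b) in H2 by field.
      unfold D in *. lra. }
  destruct (Hlow a b Ha Hb) as (m & Hm & Hml).
  set (M := Rabs (ln m) + Rabs (ln (f a)) + Rabs (ln (f b))).
  assert (HM : forall s, 0 <= s <= 1 -> - M <= D s).
  { intros s Hs.
    assert (ln m <= ln (f (s * a + (1 - s) * b))).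
    { apply ln_le; [exact Hm|]. apply Hml.
      now apply convex_combination_between. }
    pose proof (Rle_abs (- ln m)) as H1. rewrite Rabs_Ropp in H1.
    pose proof (Rle_abs (ln (f a))). pose proof (Rle_abs (ln (f b))).
    pose proof (Rabs_pos (ln (f a))). pose proof (Rabs_pos (ln (f b))).
    unfold D, M. nra. }
  assert (Hn : forall n s, 0 <= s <= 1 -> - (M / 2 ^ n) <= D s).
  { induction n as [|n IH]; intros s Hs.
    - simpl. pose proof (HM s Hs). lra.
    - replace (M / 2 ^ S n) with (M / 2 ^ n / 2)
        by (simpl; field; apply pow_nonzero; lra).
      now apply Hhalf. }
  apply Rnot_lt_le. intros Hneg.
  assert (HD : D t < 0) by (unfold D; lra).
  destruct (INR_unbounded (M / - D t)) as [n Hbig].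
  pose proof (Hn n t Ht) as H.
  assert (Hp : INR n <= 2 ^ n).
  { clear. induction n as [|n IH]; [simpl; lra|]. rewrite S_INR. simpl.
    pose proof (pow_R1_Rle 2 n ltac:(lra)). lra. }
  pose proof (pow_lt 2 n ltac:(lra)) as Hp0.
  assert (M < INR n * - D t).
  { replace M with (M / - D t * - D t) by (field; lra).
    apply Rmult_lt_compat_r; lra. }
  assert (M / 2 ^ n < - D t); [|lra].
  apply Rmult_lt_reg_r with (2 ^ n); [exact Hp0|].
  unfold Rdiv. rewrite Rmult_assoc, Rinv_l by lra. nra.
Qed.

(** The concave case applied to [1 / f]. *)
Lemma log_convex_of_midpoint (lo : R) (f : R -> R) :
  (forall y, lo < y -> 0 < f y) ->
  (forall a b, lo < a -> lo < b -> f ((a + b) / 2) ^ 2 <= f a * f b) ->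
  (forall a b, lo < a -> lo < b ->
     exists m, forall c, Rmin a b <= c <= Rmax a b -> f c <= m) ->
  log_convex_on (fun y => lo < y) f.
Proof.
  intros Hpos Hmid Hup.
  destruct (log_concave_of_midpoint lo (fun y => / f y)) as [_ H].
  - intros y Hy. now apply Rinv_0_lt_compat, Hpos.
  - intros a b Ha Hb. rewrite <- Rinv_mult, pow_inv.
    apply Rinv_le_contravar; [apply pow_lt, Hpos; lra|now apply Hmid].
  - intros a b Ha Hb. destruct (Hup a b Ha Hb) as [m Hm].
    assert (0 < m).
    { apply Rlt_le_trans with (1 := Hpos a Ha). apply Hm.
      split; [apply Rmin_l|apply Rmax_l]. }
    exists (/ m). split; [now apply Rinv_0_lt_compat|].
    intros c Hc. apply Rinv_le_contravar; [|now apply Hm].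
    apply Hpos. apply Rlt_le_trans with (2 := proj1 Hc). now apply Rmin_glb_lt.
  - split; [exact Hpos|]. intros a b t Ha Hb Ht.
    specialize (H a b t Ha Hb Ht).
    rewrite !ln_Rinv in H;
      [lra| |now apply Hpos|now apply Hpos].
    apply Hpos.
    apply Rlt_le_trans with (2 := proj1 (convex_combination_between a b t Ht)).
    now apply Rmin_glb_lt.
Qed.

(** * Completely monotone functions and their closure properties *)

(** Recursion through [- f'] absorbs the alternating signs, and the finite order [n] lets sums and
    products be treated by induction without a Leibniz formula. *)
Fixpoint cm_upto (lo : R) (n : nat) (f : R -> R) : Prop :=
  (forall y, lo < y -> 0 <= f y) /\
  match n with
  | O => True
  | S n => (forall y, lo < y -> ex_derive f y) /\ cm_upto lo n (fun y => - Derive f y)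
  end.

Lemma cm_upto_nonneg (lo : R) (n : nat) (f : R -> R) (y : R) :
  cm_upto lo n f -> lo < y -> 0 <= f y.
Proof. destruct n; intros [H _]; apply H. Qed.

Lemma locally_right (lo y : R) (P : R -> Prop) :
  lo < y -> (forall u, lo < u -> P u) -> locally y P.
Proof.
  intros Hy HP. apply (filter_imp (fun u => lo < u)); [exact HP|].
  now apply open_gt.
Qed.

Lemma cm_upto_ext (lo : R) (n : nat) (f g : R -> R) :
  (forall y, lo < y -> f y = g y) -> cm_upto lo n f -> cm_upto lo n g.
Proof.
  revert f g. induction n as [|n IH]; intros f g Hfg Hf.
  - split; [|exact I]. intros y Hy. rewrite <- Hfg by exact Hy. now apply (proj1 Hf).
  - destruct Hf as (Hpos & Hex & Hf). split; [|split].
    + intros y Hy. rewrite <- Hfg by exact Hy. now apply Hpos.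
    + intros y Hy. apply ex_derive_ext_loc with f; [|now apply Hex].
      now apply locally_right with lo.
    + apply IH with (2 := Hf). intros y Hy. f_equal.
      apply Derive_ext_loc. now apply locally_right with lo.
Qed.

Lemma cm_upto_succ (lo : R) (n : nat) (f g : R -> R) :
  (forall y, lo < y -> 0 <= f y) -> (forall y, lo < y -> is_derive f y (- g y)) ->
  cm_upto lo n g -> cm_upto lo (S n) f.
Proof.
  intros Hpos Hder Hg. split; [exact Hpos|split].
  - intros y Hy. eexists. now apply Hder.
  - apply cm_upto_ext with (2 := Hg). intros y Hy.
    rewrite (is_derive_unique _ _ _ (Hder y Hy)). ring.
Qed.

Lemma cm_upto_pred (lo : R) (n : nat) (f : R -> R) : cm_upto lo (S n) f -> cm_upto lo n f.
Proof.
  revert f. induction n as [|n IH]; intros f (Hpos & Hex & Hf).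
  - now split.
  - split; [exact Hpos|split; [exact Hex|now apply IH]].
Qed.

(** The double negation matches the form [- g y] asked for by [cm_upto_succ], with [g] built from
    [- f']. *)
Lemma cm_upto_is_derive (lo : R) (n : nat) (f : R -> R) (y : R) :
  cm_upto lo (S n) f -> lo < y -> is_derive f y (- - Derive f y).
Proof.
  intros (_ & Hex & _) Hy. rewrite Ropp_involutive. now apply Derive_correct, Hex.
Qed.

Lemma cm_upto_plus (lo : R) (n : nat) (f g : R -> R) :
  cm_upto lo n f -> cm_upto lo n g -> cm_upto lo n (fun y => f y + g y).
Proof.
  revert f g. induction n as [|n IH]; intros f g Hf Hg.
  - split; [|exact I]. intros y Hy.
    pose proof (proj1 Hf y Hy). pose proof (proj1 Hg y Hy). lra.
  - apply cm_upto_succ with (fun y => - Derive f y + - Derive g y).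
    + intros y Hy. pose proof (proj1 Hf y Hy). pose proof (proj1 Hg y Hy). lra.
    + intros y Hy. rewrite Ropp_plus_distr.
      apply (is_derive_plus (V := R_NormedModule));
        now apply (cm_upto_is_derive lo n).
    + apply IH; [apply Hf|apply Hg].
Qed.

Lemma cm_upto_mult (lo : R) (n : nat) (f g : R -> R) :
  cm_upto lo n f -> cm_upto lo n g -> cm_upto lo n (fun y => f y * g y).
Proof.
  revert f g. induction n as [|n IH]; intros f g Hf Hg.
  - split; [|exact I]. intros y Hy.
    apply Rmult_le_pos; [now apply (proj1 Hf)|now apply (proj1 Hg)].
  - apply cm_upto_succ with (fun y => - Derive f y * g y + f y * - Derive g y).
    + intros y Hy. apply Rmult_le_pos; [now apply (proj1 Hf)|now apply (proj1 Hg)].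
    + intros y Hy.
      replace (- (- Derive f y * g y + f y * - Derive g y))
        with (- - Derive f y * g y + f y * - - Derive g y) by ring.
      exact (is_derive_mult (K := R_AbsRing) f g y _ _
        (cm_upto_is_derive lo n f y Hf Hy) (cm_upto_is_derive lo n g y Hg Hy) Rmult_comm).
    + apply cm_upto_plus; apply IH; try (now apply cm_upto_pred);
        [apply Hf|apply Hg].
Qed.

Lemma cm_upto_const (lo c : R) (n : nat) : 0 <= c -> cm_upto lo n (fun _ => c).
Proof.
  revert c. induction n as [|n IH]; intros c Hc.
  - split; [now intros|exact I].
  - apply cm_upto_succ with (fun _ => 0); [now intros| |apply IH; lra].
    intros y Hy. rewrite Ropp_0. apply (is_derive_const (V := R_NormedModule)).
Qed.

Lemma cm_upto_inv (lo c : R) (n : nat) : 0 <= lo + c -> cm_upto lo n (fun y => / (y + c)).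
Proof.
  intros Hc.
  assert (Hpos : forall y, lo < y -> 0 <= / (y + c))
    by (intros y Hy; left; apply Rinv_0_lt_compat; lra).
  induction n as [|n IH]; [now split|].
  apply cm_upto_succ with (fun y => / (y + c) * / (y + c)); [exact Hpos| |].
  - intros y Hy. auto_derive; [lra|]. field. lra.
  - now apply cm_upto_mult.
Qed.

Definition completely_monotone (lo : R) (f : R -> R) : Prop := forall n, cm_upto lo n f.

Lemma completely_monotone_opp_Derive (lo : R) (f : R -> R) :
  completely_monotone lo f -> completely_monotone lo (fun y => - Derive f y).
Proof. intros Hf n. apply (Hf (S n)). Qed.

Lemma completely_monotonic_on_intro (lo : R) (f : R -> R) :
  completely_monotone lo f -> completely_monotonic_on (fun y => lo < y) f.
Proof.
  intros Hf.
  assert (H : forall m, completely_monotone lo (fun y => (-1) ^ m * Derive_n f m y)).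
  { induction m as [|m IH]; intros n.
    - apply cm_upto_ext with (2 := Hf n). intros y Hy. simpl. ring.
    - apply cm_upto_ext with (2 := completely_monotone_opp_Derive _ _ IH n).
      intros y Hy. rewrite Derive_scal. simpl. ring. }
  intros m y Hy. split.
  - destruct m as [|m]; [exact I|]. simpl.
    destruct (H m 1%nat) as (_ & Hex & _).
    (* The sign is its own inverse, so a second factor [(-1)^m] recovers the bare derivative. *)
    apply ex_derive_ext with (fun u => (-1) ^ m * ((-1) ^ m * Derive_n f m u)).
    + intros u. rewrite <- Rmult_assoc, <- Rpow_mult_distr.
      replace (-1 * -1) with 1 by ring. rewrite pow1. apply Rmult_1_l.
    + apply ex_derive_scal. now apply Hex.
  - apply (cm_upto_nonneg lo 0 (fun y => (-1) ^ m * Derive_n f m y)); [apply H|exact Hy].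
Qed.

(** * Derivative bounds and pointwise limits *)

Lemma MVT_right (lo : R) (f : R -> R) (u v : R) :
  (forall y, lo < y -> ex_derive f y) -> lo < u -> lo < v ->
  exists c, Rmin u v <= c <= Rmax u v /\ f v - f u = Derive f c * (v - u).
Proof.
  intros Hf Hu Hv.
  assert (Hmin : lo < Rmin u v) by now apply Rmin_glb_lt.
  apply MVT_gen.
  - intros y Hy. apply Derive_correct, Hf. lra.
  - intros y Hy. apply continuity_pt_filterlim.
    apply (ex_derive_continuous (V := R_NormedModule)), Hf. lra.
Qed.

Lemma completely_monotone_decr (lo : R) (f : R -> R) (u v : R) :
  completely_monotone lo f -> lo < u -> u <= v -> f v <= f u.
Proof.
  intros Hf Hu Huv.
  destruct (MVT_right lo f u v) as (c & Hc & E); try lra.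
  { apply (Hf 1%nat). }
  rewrite Rmin_left in Hc by lra.
  pose proof (cm_upto_nonneg lo 0 _ c (completely_monotone_opp_Derive lo f Hf 0%nat)
    ltac:(lra)). nra.
Qed.

(** As [- f'] decreases, [d] times its value at [y] is at most the drop [f (y - d) - f y], and
    [f y >= 0]. A derivative is thus bounded by a value of the function itself. *)
Lemma completely_monotone_Derive_bound (lo d : R) (f : R -> R) (y : R) :
  completely_monotone lo f -> 0 < d -> lo < y - d -> d * - Derive f y <= f (y - d).
Proof.
  intros Hf Hd Hy.
  destruct (MVT_right lo f (y - d) y) as (c & Hc & E); try lra.
  { apply (Hf 1%nat). }
  rewrite Rmin_left, Rmax_right in Hc by lra.
  pose proof (completely_monotone_decr lo _ c y (completely_monotone_opp_Derive lo f Hf)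
    ltac:(lra) ltac:(lra)) as H. simpl in H.
  pose proof (cm_upto_nonneg lo 0 f y (Hf 0%nat) ltac:(lra)). nra.
Qed.

(** The three steps of length [d] are spent as follows: one leaves room for [h], one bounds [f''] by
    [- f' / d], and one bounds [- f'] by [f / d]. Two uses of the mean value theorem give the error
    without the factor [1/2]. *)
Lemma completely_monotone_taylor (lo d : R) (f : R -> R) (y h : R) :
  completely_monotone lo f -> 0 < d -> lo < y - 3 * d -> Rabs h <= d ->
  Rabs (f (y + h) - f y - h * Derive f y) <= h ^ 2 * (f (y - 3 * d) / d ^ 2).
Proof.
  intros Hf Hd Hy Hh.
  assert (Hhb : - d <= h <= d) by (now apply Rabs_le_between).
  set (g := fun u => - Derive f u).
  assert (Hg : completely_monotone lo g) by now apply completely_monotone_opp_Derive.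
  assert (Hbound : forall u, y - d <= u -> 0 <= - Derive g u <= f (y - 3 * d) / d ^ 2).
  { intros u Hu. split.
    - apply (cm_upto_nonneg lo 0 _ u (completely_monotone_opp_Derive lo g Hg 0%nat)). lra.
    - pose proof (completely_monotone_decr lo _ (y - d) u
        (completely_monotone_opp_Derive lo g Hg) ltac:(lra) Hu) as H1. simpl in H1.
      pose proof (completely_monotone_Derive_bound lo d g (y - d) Hg Hd ltac:(lra)) as H2.
      pose proof (completely_monotone_Derive_bound lo d f (y - d - d) Hf Hd ltac:(lra)) as H3.
      replace (y - d - d - d) with (y - 3 * d) in H3 by ring.
      fold (g (y - d - d)) in H3.
      apply Rle_trans with (1 := H1).
      apply Rmult_le_reg_l with (d ^ 2); [now apply pow_lt|].
      replace (d ^ 2 * (f (y - 3 * d) / d ^ 2)) with (f (y - 3 * d)) by (field; lra).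
      apply Rle_trans with (2 := H3). simpl. nra. }
  destruct (MVT_right lo f y (y + h)) as (c & Hc & E); try lra.
  { apply (Hf 1%nat). }
  assert (Hc' : Rabs (c - y) <= Rabs h /\ y - d <= c).
  { revert Hc. unfold Rmin, Rmax, Rabs.
    destruct (Rle_dec y (y + h)), (Rcase_abs (c - y)), (Rcase_abs h); lra. }
  destruct Hc' as [Hcy Hcd].
  destruct (MVT_right lo g y c) as (e & He & E2); try lra.
  { apply (Hg 1%nat). }
  assert (Hed : y - d <= e).
  { apply Rle_trans with (2 := proj1 He). apply Rmin_glb; lra. }
  destruct (Hbound e Hed) as [B0 B1].
  replace (f (y + h) - f y - h * Derive f y) with (h * (c - y) * - Derive g e).
  2:{ rewrite E. unfold g in E2 at 1 2. replace (y + h - y) with h by ring. nra. }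
  rewrite !Rabs_mult, (Rabs_pos_eq (- Derive g e)) by exact B0.
  rewrite <- (pow2_abs h).
  replace (Rabs h ^ 2) with (Rabs h * Rabs h) by ring.
  apply Rmult_le_compat; [apply Rmult_le_pos; apply Rabs_pos|exact B0| |exact B1].
  apply Rmult_le_compat_l; [apply Rabs_pos|exact Hcy].
Qed.

Lemma is_derive_of_quadratic_error (f : R -> R) (y l d B : R) :
  0 < d -> (forall h, Rabs h <= d -> Rabs (f (y + h) - f y - h * l) <= h ^ 2 * B) ->
  is_derive f y l.
Proof.
  intros Hd H. apply is_derive_Reals. intros eps He.
  assert (HB : 0 < Rabs B + 1) by (pose proof (Rabs_pos B); lra).
  assert (Hr : 0 < eps / (Rabs B + 1)) by now apply Rdiv_lt_0_compat.
  exists (mkposreal _ (Rmin_glb_lt _ _ _ Hd Hr)). intros h Hh0 Hh. simpl in Hh.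
  assert (Hh1 : 0 < Rabs h) by now apply Rabs_pos_lt.
  pose proof (Rlt_le_trans _ _ _ Hh (Rmin_l _ _)) as Hhd.
  pose proof (Rlt_le_trans _ _ _ Hh (Rmin_r _ _)) as Hhr.
  replace ((f (y + h) - f y) / h - l) with ((f (y + h) - f y - h * l) / h) by (field; exact Hh0).
  rewrite Rabs_div by exact Hh0.
  apply Rmult_lt_reg_r with (Rabs h); [exact Hh1|].
  unfold Rdiv. rewrite Rmult_assoc, Rinv_l, Rmult_1_r by lra.
  apply Rle_lt_trans with (1 := H h (Rlt_le _ _ Hhd)).
  rewrite <- pow2_abs.
  assert (Rabs h * (Rabs B + 1) < eps).
  { replace eps with (eps / (Rabs B + 1) * (Rabs B + 1)) by (field; lra).
    apply Rmult_lt_compat_r; assumption. }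
  pose proof (Rle_abs B). nra.
Qed.

(* The Taylor error of [completely_monotone_taylor] is uniform along the
   sequence, so the derivatives converge together with the difference quotients. *)
Lemma completely_monotone_Derive_lim (lo : R) (fk : nat -> R -> R) (f : R -> R) (y : R) :
  (forall k, completely_monotone lo (fk k)) ->
  (forall u, lo < u -> is_lim_seq (fun k => fk k u) (f u)) -> lo < y ->
  exists l : R, is_lim_seq (fun k => Derive (fk k) y) l /\ is_derive f y l.
Proof.
  intros Hcm Hlim Hy.
  set (d := (y - lo) / 4). assert (Hd : 0 < d) by (unfold d; lra).
  assert (Hd3 : lo < y - 3 * d) by (unfold d; lra).
  assert (Hbd : exists K, forall k, fk k (y - 3 * d) <= K).
  { destruct (filterlim_bounded (fun k => fk k (y - 3 * d))) as [K HK].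
    - exists (f (y - 3 * d)). now apply Hlim.
    - exists K. intros k. apply Rle_trans with (2 := HK k). apply Rle_abs. }
  destruct Hbd as [K HK]. set (B := K / d ^ 2).
  assert (Htay : forall k h, Rabs h <= d ->
            Rabs (fk k (y + h) - fk k y - h * Derive (fk k) y) <= h ^ 2 * B).
  { intros k h Hh.
    apply Rle_trans with (1 := completely_monotone_taylor lo d (fk k) y h (Hcm k) Hd Hd3 Hh).
    apply Rmult_le_compat_l; [apply pow2_ge_0|].
    apply Rmult_le_compat_r; [|apply HK].
    left. now apply Rinv_0_lt_compat, pow_lt. }
  assert (Hex : ex_finite_lim_seq (fun k => Derive (fk k) y)).
  { apply ex_lim_seq_cauchy_corr. intros [eps He].
    assert (HB : 0 < Rabs B + 1) by (pose proof (Rabs_pos B); lra).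
    (* For this fixed [h] each of the two Taylor errors is at most [eps h / 4], and the increments
       [q n], [q m] eventually differ by less than [eps h / 4]. *)
    set (h := Rmin d (eps / (4 * (Rabs B + 1)))).
    assert (Hh0 : 0 < h).
    { apply Rmin_glb_lt; [exact Hd|]. apply Rdiv_lt_0_compat; lra. }
    assert (HhB : h * Rabs B <= eps / 4).
    { apply Rle_trans with (eps / (4 * (Rabs B + 1)) * (Rabs B + 1)).
      - apply Rmult_le_compat; [lra|apply Rabs_pos|apply Rmin_r|lra].
      - right. field. lra. }
    assert (Hhd : Rabs h <= d) by (rewrite Rabs_pos_eq by lra; apply Rmin_l).
    set (q := fun k => fk k (y + h) - fk k y).
    assert (Hq : ex_finite_lim_seq q).
    { exists (f (y + h) - f y). apply is_lim_seq_minus'; apply Hlim; lra. }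
    apply ex_lim_seq_cauchy_corr in Hq.
    assert (He2 : 0 < eps * h / 4) by (apply Rdiv_lt_0_compat; [now apply Rmult_lt_0_compat|lra]).
    destruct (Hq (mkposreal _ He2)) as [N HN]. simpl in HN.
    exists N. intros n m Hn Hm. simpl.
    specialize (HN n m Hn Hm).
    pose proof (Htay n h Hhd) as Tn. pose proof (Htay m h Hhd) as Tm.
    fold (q n) in Tn. fold (q m) in Tm.
    apply Rmult_lt_reg_l with h; [exact Hh0|].
    rewrite <- (Rabs_pos_eq h) at 1 by lra. rewrite <- Rabs_mult.
    assert (h ^ 2 * B <= eps * h / 4) by (pose proof (Rle_abs B); nra).
    apply Rabs_lt_between.
    apply Rabs_lt_between in HN. apply Rabs_le_between in Tn. apply Rabs_le_between in Tm.
    assert (0 < eps * h) by now apply Rmult_lt_0_compat. lra. }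
  destruct Hex as [l Hl]. exists l. split; [exact Hl|].
  apply is_derive_of_quadratic_error with d B; [exact Hd|].
  intros h Hh.
  assert (lo < y + h) by (apply Rabs_le_between in Hh; unfold d in *; lra).
  apply (is_lim_seq_le (fun k => Rabs (fk k (y + h) - fk k y - h * Derive (fk k) y))
    (fun _ => h ^ 2 * B) (Rabs (f (y + h) - f y - h * l)) (h ^ 2 * B)).
  - intros k. now apply Htay.
  - apply (is_lim_seq_abs _ (f (y + h) - f y - h * l)).
    apply is_lim_seq_minus'; [apply is_lim_seq_minus'; now apply Hlim|].
    apply (is_lim_seq_scal_l _ h l Hl).
  - apply is_lim_seq_const.
Qed.

Lemma completely_monotone_lim (lo : R) (fk : nat -> R -> R) (f : R -> R) :
  (forall k, completely_monotone lo (fk k)) ->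
  (forall y, lo < y -> is_lim_seq (fun k => fk k y) (f y)) ->
  completely_monotone lo f.
Proof.
  intros Hcm Hlim n. revert fk f Hcm Hlim.
  induction n as [|n IH]; intros fk f Hcm Hlim.
  all: assert (Hpos : forall y, lo < y -> 0 <= f y)
    by (intros y Hy;
        apply (is_lim_seq_le (fun _ => 0) (fun k => fk k y) 0 (f y));
        [intros k; apply (cm_upto_nonneg lo 0); [apply Hcm|exact Hy]
        |apply is_lim_seq_const|now apply Hlim]).
  - now split.
  - split; [exact Hpos|split].
    + intros y Hy.
      destruct (completely_monotone_Derive_lim lo fk f y Hcm Hlim Hy) as (l & _ & Hl).
      now exists l.
    + apply (IH (fun k y => - Derive (fk k) y)).
      * intros k. now apply completely_monotone_opp_Derive.
      * intros y Hy.
        destruct (completely_monotone_Derive_lim lo fk f y Hcm Hlim Hy) as (l & Hl & Hd).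
        rewrite (is_derive_unique _ _ _ Hd). now apply (is_lim_seq_opp _ l).
Qed.

(** * The class of completely monotone, midpoint log-convex functions *)

Definition log_convex_cm (lo : R) (f : R -> R) : Prop :=
  completely_monotone lo f /\
  forall a b, lo < a -> lo < b -> f ((a + b) / 2) ^ 2 <= f a * f b.

Lemma log_convex_cm_nonneg (lo : R) (f : R -> R) (y : R) :
  log_convex_cm lo f -> lo < y -> 0 <= f y.
Proof. intros [Hf _]. apply (cm_upto_nonneg lo 0), Hf. Qed.

Lemma log_convex_cm_ext (lo : R) (f g : R -> R) :
  (forall y, lo < y -> f y = g y) -> log_convex_cm lo f -> log_convex_cm lo g.
Proof.
  intros Hfg [Hf Hmid]. split.
  - intros n. now apply cm_upto_ext with f.
  - intros a b Ha Hb. rewrite <- !Hfg by lra. now apply Hmid.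
Qed.

Lemma log_convex_cm_const (lo c : R) : 0 <= c -> log_convex_cm lo (fun _ => c).
Proof.
  intros Hc. split.
  - intros n. now apply cm_upto_const.
  - intros; simpl; lra.
Qed.

Lemma log_convex_cm_inv (lo c : R) : 0 <= lo + c -> log_convex_cm lo (fun y => / (y + c)).
Proof.
  intros Hc. split.
  - intros n. now apply cm_upto_inv.
  - intros a b Ha Hb. rewrite <- Rinv_mult, pow_inv.
    assert (0 < (a + c) * (b + c)) by (apply Rmult_lt_0_compat; lra).
    apply Rinv_le_contravar; [assumption|].
    pose proof (pow2_ge_0 (a - b)). nra.
Qed.

Lemma log_convex_cm_mult (lo : R) (f g : R -> R) :
  log_convex_cm lo f -> log_convex_cm lo g -> log_convex_cm lo (fun y => f y * g y).
Proof.
  intros Hf Hg. split.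
  - intros n. apply cm_upto_mult; [apply Hf|apply Hg].
  - intros a b Ha Hb.
    pose proof (proj2 Hf a b Ha Hb). pose proof (proj2 Hg a b Ha Hb).
    rewrite Rpow_mult_distr.
    replace (f a * g a * (f b * g b)) with (f a * f b * (g a * g b)) by ring.
    apply Rmult_le_compat; try apply pow2_ge_0; assumption.
Qed.

Lemma log_convex_cm_plus (lo : R) (f g : R -> R) :
  log_convex_cm lo f -> log_convex_cm lo g -> log_convex_cm lo (fun y => f y + g y).
Proof.
  intros Hf Hg. split.
  - intros n. apply cm_upto_plus; [apply Hf|apply Hg].
  - intros a b Ha Hb.
    pose proof (log_convex_cm_nonneg lo f a Hf Ha).
    pose proof (log_convex_cm_nonneg lo f b Hf Hb).
    pose proof (log_convex_cm_nonneg lo g a Hg Ha).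
    pose proof (log_convex_cm_nonneg lo g b Hg Hb).
    pose proof (log_convex_cm_nonneg lo f ((a + b) / 2) Hf ltac:(lra)).
    pose proof (log_convex_cm_nonneg lo g ((a + b) / 2) Hg ltac:(lra)).
    pose proof (proj2 Hf a b Ha Hb) as Mf. pose proof (proj2 Hg a b Ha Hb) as Mg.
    set (u := f ((a + b) / 2)) in *. set (v := g ((a + b) / 2)) in *.
    (* The mixed term of [(u + v)^2]: multiply the two midpoint inequalities, then compare geometric
       and arithmetic means of [f a * g b] and [f b * g a]. *)
    assert (Hcross : 2 * (u * v) <= f a * g b + f b * g a).
    { assert (Huv : (u * v) ^ 2 <= (f a * g b) * (f b * g a)).
      { rewrite Rpow_mult_distr.
        replace (f a * g b * (f b * g a)) with (f a * f b * (g a * g b)) by ring.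
        apply Rmult_le_compat; try apply pow2_ge_0; assumption. }
      assert (0 <= f a * g b) by now apply Rmult_le_pos.
      assert (0 <= f b * g a) by now apply Rmult_le_pos.
      assert (0 <= u * v) by now apply Rmult_le_pos.
      pose proof (pow2_ge_0 (f a * g b - f b * g a)).
      apply Rsqr_incr_0_var; [unfold Rsqr; nra|lra]. }
    simpl in *. nra.
Qed.

Lemma log_convex_cm_sum (lo : R) (f : nat -> R -> R) (n : nat) :
  (forall k, log_convex_cm lo (f k)) -> log_convex_cm lo (fun y => sum_n (fun k => f k y) n).
Proof.
  intros Hf. induction n as [|n IH].
  - apply log_convex_cm_ext with (2 := Hf 0%nat). intros y _. now rewrite sum_O.
  - apply log_convex_cm_ext with (2 := log_convex_cm_plus _ _ _ IH (Hf (S n))).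
    intros y _. now rewrite sum_Sn.
Qed.

Lemma log_convex_cm_lim (lo : R) (fk : nat -> R -> R) (f : R -> R) :
  (forall k, log_convex_cm lo (fk k)) ->
  (forall y, lo < y -> is_lim_seq (fun k => fk k y) (f y)) ->
  log_convex_cm lo f.
Proof.
  intros Hk Hlim. split.
  - apply completely_monotone_lim with fk; [apply Hk|exact Hlim].
  - intros a b Ha Hb.
    pose proof (Hlim a Ha) as La. pose proof (Hlim b Hb) as Lb.
    pose proof (Hlim ((a + b) / 2) ltac:(lra)) as Lm.
    apply (is_lim_seq_le (fun k => fk k ((a + b) / 2) ^ 2) (fun k => fk k a * fk k b)
             (f ((a + b) / 2) ^ 2) (f a * f b)).
    + intros k. now apply (proj2 (Hk k)).
    + simpl. apply is_lim_seq_mult'; [exact Lm|].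
      apply is_lim_seq_mult'; [exact Lm|apply is_lim_seq_const].
    + now apply is_lim_seq_mult'.
Qed.

(** * The functions Phi and Psi *)

Definition gamma_ratio (nu : R) : R := Gamma_pos (nu + / 2) / Gamma_pos (nu + 1).

(** Each factor equals [(nu + k + 1) / (nu + k + 1/2)], the quotient of the two Gamma recurrences.
    Its pole for [k = 0] is the endpoint [-1/2]. *)
Fixpoint gamma_ratio_prod (n : nat) (nu : R) : R :=
  match n with
  | O => 1
  | S k => gamma_ratio_prod k nu * (1 + / 2 * / (nu + (/ 2 + INR k)))
  end.

Lemma gamma_ratio_gt0 (nu : R) : - / 2 < nu -> 0 < gamma_ratio nu.
Proof. intros Hnu. apply Rdiv_lt_0_compat; apply Gamma_pos_gt0; lra. Qed.

Lemma gamma_ratio_succ (nu : R) :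
  - / 2 < nu -> gamma_ratio nu = (1 + / 2 * / (nu + / 2)) * gamma_ratio (nu + 1).
Proof.
  intros Hnu. unfold gamma_ratio.
  replace (nu + 1 + / 2) with (nu + / 2 + 1) by ring.
  rewrite (Gamma_pos_succ (nu + / 2)), (Gamma_pos_succ (nu + 1)) by lra.
  pose proof (Gamma_pos_gt0 (nu + / 2) ltac:(lra)).
  pose proof (Gamma_pos_gt0 (nu + 1) ltac:(lra)).
  field. lra.
Qed.

Lemma gamma_ratio_prodE (n : nat) (nu : R) :
  - / 2 < nu -> gamma_ratio nu = gamma_ratio_prod n nu * gamma_ratio (nu + INR n).
Proof.
  intros Hnu. induction n as [|n IH].
  - simpl. rewrite Rplus_0_r. ring.
  - rewrite IH. pose proof (pos_INR n).
    rewrite (gamma_ratio_succ (nu + INR n)) by lra.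
    rewrite S_INR. simpl.
    replace (nu + INR n + 1) with (nu + (INR n + 1)) by ring.
    replace (nu + INR n + / 2) with (nu + (/ 2 + INR n)) by ring. ring.
Qed.

(** Midpoint inequalities for Gamma on the unit intervals centred at [nu + 1] and [nu + 3/2].
    Together they say that [gamma_ratio nu] behaves like [nu^(-1/2)] for large [nu]. *)
Lemma gamma_ratio_sqr_bounds (nu : R) :
  - / 2 < nu ->
  1 <= (nu + / 2) * gamma_ratio nu ^ 2 /\
  (nu + / 2) ^ 2 * gamma_ratio nu ^ 2 <= nu + 1.
Proof.
  intros Hnu.
  pose proof (Gamma_pos_midpoint (nu + / 2) (nu + / 2 + 1) ltac:(lra) ltac:(lra)) as H1.
  pose proof (Gamma_pos_midpoint (nu + 1) (nu + 1 + 1) ltac:(lra) ltac:(lra)) as H2.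
  replace ((nu + / 2 + (nu + / 2 + 1)) / 2) with (nu + 1) in H1 by field.
  replace ((nu + 1 + (nu + 1 + 1)) / 2) with (nu + / 2 + 1) in H2 by field.
  rewrite (Gamma_pos_succ (nu + / 2)) in H1, H2 by lra.
  rewrite (Gamma_pos_succ (nu + 1)) in H2 by lra.
  unfold gamma_ratio.
  pose proof (Gamma_pos_gt0 (nu + / 2) ltac:(lra)) as G1.
  pose proof (Gamma_pos_gt0 (nu + 1) ltac:(lra)) as G2.
  set (g := Gamma_pos (nu + / 2)) in *. set (h := Gamma_pos (nu + 1)) in *.
  assert (Hh : 0 < h ^ 2) by now apply pow_lt.
  split; apply Rmult_le_reg_r with (h ^ 2); try exact Hh.
  - replace ((nu + / 2) * (g / h) ^ 2 * h ^ 2) with ((nu + / 2) * g ^ 2) by (field; lra). nra.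
  - replace ((nu + / 2) ^ 2 * (g / h) ^ 2 * h ^ 2) with (((nu + / 2) * g) ^ 2) by (field; lra). nra.
Qed.

(* Gauss' product: the bounds above give [sqrt n * gamma_ratio (nu + n) -> 1]. *)
Lemma is_lim_seq_gamma_ratio_prod (nu : R) :
  - / 2 < nu ->
  is_lim_seq (fun n => / sqrt (INR (S n)) * gamma_ratio_prod (S n) nu) (gamma_ratio nu).
Proof.
  intros Hnu. set (c := nu + / 2). assert (Hc : 0 < c) by (unfold c; lra).
  pose proof (gamma_ratio_gt0 nu Hnu) as Hr. set (r := gamma_ratio nu) in *.
  set (P := fun n => / sqrt (INR (S n)) * gamma_ratio_prod (S n) nu).
  assert (HP : forall n, 0 < P n /\
    r ^ 2 * (1 - (c + 1) * / (INR n + 1)) <= P n ^ 2 <= r ^ 2 * (1 + c * / (INR n + 1))).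
  { intros n. pose proof (pos_INR n) as Hn0.
    pose proof (gamma_ratio_prodE (S n) nu Hnu) as E.
    set (N := INR (S n)) in *.
    assert (HN : INR n + 1 = N) by (unfold N; rewrite S_INR; reflexivity).
    pose proof (gamma_ratio_gt0 (nu + N) ltac:(lra)) as Hq.
    destruct (gamma_ratio_sqr_bounds (nu + N) ltac:(lra)) as [B1 B2].
    replace (nu + N + / 2) with (N + c) in B1, B2 by (unfold c; ring).
    set (q := gamma_ratio (nu + N)) in *. fold r in E.
    assert (Hsq : 0 < sqrt N) by (apply sqrt_lt_R0; lra).
    assert (HPn : P n = r / (sqrt N * q)).
    { unfold P. fold N. rewrite E. field. lra. }
    assert (HP2 : P n ^ 2 = r ^ 2 / (N * q ^ 2)).
    { rewrite HPn. rewrite <- (sqrt_sqrt N) at 2 by lra. field. lra. }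
    assert (Hden : 0 < N * q ^ 2) by (apply Rmult_lt_0_compat; [lra|now apply pow_lt]).
    assert (Hr2 : 0 < r ^ 2) by now apply pow_lt.
    split; [rewrite HPn; apply Rdiv_lt_0_compat; [exact Hr|now apply Rmult_lt_0_compat]|].
    rewrite HP2, HN. unfold Rdiv.
    split; (apply Rmult_le_compat_l; [lra|]);
      apply Rmult_le_reg_r with (N * q ^ 2); try exact Hden;
      rewrite Rinv_l by lra.
    - replace ((1 - (c + 1) * / N) * (N * q ^ 2)) with ((N - c - 1) * q ^ 2) by (field; lra).
      assert (Hq2 : 0 < q ^ 2) by now apply pow_lt.
      apply Rmult_le_reg_l with ((N + c) ^ 2); [apply pow_lt; lra|].
      (* For [N <= c + 1] the left side is not positive; otherwise [B2] may be multiplied by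
         [N - c - 1], leaving a polynomial inequality. *)
      destruct (Rle_dec (N - c - 1) 0) as [Hle|Hgt].
      + assert (0 <= (N + c) ^ 2 * q ^ 2 * (- (N - c - 1)))
          by (apply Rmult_le_pos; [apply Rmult_le_pos; [apply pow2_ge_0|lra]|lra]).
        pose proof (pow2_ge_0 (N + c)). nra.
      + assert ((N - c - 1) * ((N + c) ^ 2 * q ^ 2) <= (N - c - 1) * (nu + N + 1))
          by (apply Rmult_le_compat_l; lra).
        unfold c in *. nra.
    - replace ((1 + c * / N) * (N * q ^ 2)) with ((N + c) * q ^ 2) by (field; lra).
      exact B1. }
  assert (Hinv : is_lim_seq (fun n => / (INR n + 1)) 0).
  { apply is_lim_seq_ext with (fun n => / INR (S n)).
    { intros n. now rewrite S_INR. }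
    apply (is_lim_seq_incr_1 (fun n => / INR n) 0).
    replace (Finite 0) with (Rbar_inv p_infty) by reflexivity.
    apply is_lim_seq_inv; [apply is_lim_seq_INR|discriminate]. }
  assert (Haff : forall k, is_lim_seq (fun n => r ^ 2 * (1 + k * / (INR n + 1))) (r ^ 2)).
  { intros k.
    replace (Finite (r ^ 2)) with (Finite (r ^ 2 * (1 + k * 0))) by (f_equal; ring).
    apply (is_lim_seq_scal_l _ (r ^ 2) (1 + k * 0)).
    apply is_lim_seq_plus'; [apply is_lim_seq_const|].
    now apply (is_lim_seq_scal_l _ k 0). }
  assert (Hsqr : is_lim_seq (fun n => P n ^ 2) (r ^ 2)).
  { apply (is_lim_seq_le_le (fun n => r ^ 2 * (1 + - (c + 1) * / (INR n + 1))) _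
             (fun n => r ^ 2 * (1 + c * / (INR n + 1)))); [|apply Haff|apply Haff].
    intros n. destruct (HP n) as [_ H]. lra. }
  apply is_lim_seq_ext with (fun n => sqrt (P n ^ 2)).
  { intros n. apply sqrt_pow2. left. apply HP. }
  rewrite <- (sqrt_pow2 r) by lra.
  apply is_lim_seq_continuous; [apply continuity_pt_sqrt, pow2_ge_0|exact Hsqr].
Qed.

Lemma log_convex_cm_gamma_ratio : log_convex_cm (- / 2) gamma_ratio.
Proof.
  apply log_convex_cm_lim with (fun n nu => / sqrt (INR (S n)) * gamma_ratio_prod (S n) nu);
    [|apply is_lim_seq_gamma_ratio_prod].
  intros n. apply log_convex_cm_mult.
  - apply log_convex_cm_const. left. apply Rinv_0_lt_compat, sqrt_lt_R0, lt_0_INR. lia.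
  - generalize (S n). clear n. intros n. induction n as [|n IH].
    + apply (log_convex_cm_const _ 1). lra.
    + apply (log_convex_cm_mult _ (gamma_ratio_prod n)); [exact IH|].
      apply log_convex_cm_plus; [apply log_convex_cm_const; lra|].
      apply log_convex_cm_mult; [apply log_convex_cm_const; lra|].
      apply log_convex_cm_inv. pose proof (pos_INR n). lra.
Qed.

Lemma log_convex_cm_gamma_rgamma (k : nat) :
  log_convex_cm (- / 2) (fun nu => Gamma_pos (nu + / 2) * rgamma (INR k + nu + 1)).
Proof.
  induction k as [|k IH].
  - apply log_convex_cm_ext with (2 := log_convex_cm_gamma_ratio). intros nu Hnu.
    simpl. rewrite Rplus_0_l, rgamma_pos_arg by lra. reflexivity.
  - pose proof (pos_INR k).
    apply log_convex_cm_ext with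
      (fun nu => / (nu + (INR k + 1)) * (Gamma_pos (nu + / 2) * rgamma (INR k + nu + 1))).
    + intros nu Hnu. rewrite (rgamma_succ (INR k + nu + 1)), S_INR.
      replace (INR k + 1 + nu + 1) with (INR k + nu + 1 + 1) by ring. field. lra.
    + apply log_convex_cm_mult; [|exact IH]. apply log_convex_cm_inv. lra.
Qed.

(** The shifts [i = 0] and [i = 1] are the two sums of [bessel_pair]; a natural shift of the order
    merely moves the Gamma index from [k] to [k + i]. *)
Lemma log_convex_cm_gamma_bessel_sum (w : R) (i : nat) :
  0 <= w ->
  log_convex_cm (- / 2) (fun nu => Gamma_pos (nu + / 2) * bessel_sum w (nu + INR i)).
Proof.
  intros Hw.
  apply log_convex_cm_lim with (fun n nu => sum_n (fun k =>
    w ^ k / INR (fact k) * (Gamma_pos (nu + / 2) * rgamma (INR (k + i) + nu + 1))) n).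
  - intros n.
    apply (log_convex_cm_sum _ (fun k nu =>
      w ^ k / INR (fact k) * (Gamma_pos (nu + / 2) * rgamma (INR (k + i) + nu + 1)))).
    intros k. apply log_convex_cm_mult; [|apply log_convex_cm_gamma_rgamma].
    apply log_convex_cm_const.
    apply Rdiv_le_0_compat; [now apply pow_le|apply INR_fact_lt_0].
  - intros nu Hnu. pose proof (pos_INR i).
    apply (is_lim_seq_ext (fun n => Gamma_pos (nu + / 2)
                                    * sum_n (bessel_term w (nu + INR i)) n)).
    + intros n. rewrite <- (sum_n_mult_l (K := R_Ring) (Gamma_pos (nu + / 2))).
      apply sum_n_ext. intros k. unfold bessel_term, bessel_coef, mult; simpl.
      rewrite plus_INR. replace (INR k + INR i + nu + 1) with (INR k + (nu + INR i) + 1) by ring.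
      unfold Rdiv. ring.
    + apply (is_lim_seq_scal_l _ (Gamma_pos (nu + / 2)) (bessel_sum w (nu + INR i))).
      apply is_series_bessel; [exact Hw|lra].
Qed.

Lemma Psi_bessel_pair (nu x : R) :
  0 < x ->
  Psi nu x = sqrt PI * exp (- x) * (Gamma_pos (nu + / 2) * bessel_pair (x / 2) nu).
Proof.
  intros Hx. unfold Psi. rewrite Phi_bessel_pair, Rpower_Ropp by exact Hx.
  field. apply Rgt_not_eq, exp_pos.
Qed.

Lemma log_convex_cm_Psi (x : R) : 0 < x -> log_convex_cm (- / 2) (fun nu => Psi nu x).
Proof.
  intros Hx.
  apply log_convex_cm_ext with (fun nu => sqrt PI * exp (- x) *
    (Gamma_pos (nu + / 2) * bessel_sum ((x / 2) ^ 2) (nu + INR 0) +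
     x / 2 * (Gamma_pos (nu + / 2) * bessel_sum ((x / 2) ^ 2) (nu + INR 1)))).
  - intros nu Hnu. rewrite Psi_bessel_pair by exact Hx. unfold bessel_pair.
    simpl (INR 0). simpl (INR 1). rewrite Rplus_0_r. ring.
  - apply log_convex_cm_mult.
    + apply log_convex_cm_const. apply Rmult_le_pos; [apply sqrt_pos|left; apply exp_pos].
    + apply log_convex_cm_plus; [apply log_convex_cm_gamma_bessel_sum, pow2_ge_0|].
      apply log_convex_cm_mult; [apply log_convex_cm_const; lra|].
      apply log_convex_cm_gamma_bessel_sum, pow2_ge_0.
Qed.

Lemma bessel_pair_gt0 (z nu : R) : 0 < z -> -1 < nu -> 0 < bessel_pair z nu.
Proof.
  intros Hz Hnu. apply Rlt_le_trans with (2 := bessel_pair_ge z nu Hz Hnu).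
  apply rgamma_gt0. lra.
Qed.

Lemma Phi_gt0 (nu x : R) : 0 < x -> -1 < nu -> 0 < Phi nu x.
Proof.
  intros Hx Hnu. rewrite Phi_bessel_pair by exact Hx.
  apply Rmult_lt_0_compat; [apply Rmult_lt_0_compat; apply exp_pos|].
  apply bessel_pair_gt0; lra.
Qed.

Lemma Psi_gt0 (nu x : R) : 0 < x -> - / 2 < nu -> 0 < Psi nu x.
Proof.
  intros Hx Hnu.
  apply Rmult_lt_0_compat; [|apply Phi_gt0; lra].
  apply Rmult_lt_0_compat; [|apply Gamma_pos_gt0; lra].
  apply Rmult_lt_0_compat; [apply sqrt_lt_R0, PI_RGT_0|apply exp_pos].
Qed.

(** The prefactor [2^(-nu)] is log-linear in the order, so it cancels from every comparison between
    orders with equal sum. *)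
Lemma Phi_mul (x a b c : R) :
  0 < x -> a + b = 2 * c ->
  Phi a x * Phi b x =
  (exp (- x) * Rpower 2 (- c)) ^ 2 * (bessel_pair (x / 2) a * bessel_pair (x / 2) b).
Proof.
  intros Hx Hab. rewrite !Phi_bessel_pair by exact Hx.
  assert (E : Rpower 2 (- a) * Rpower 2 (- b) = Rpower 2 (- c) ^ 2).
  { simpl. rewrite Rmult_1_r, <- !Rpower_plus. f_equal. lra. }
  rewrite Rpow_mult_distr, <- E. ring.
Qed.

Lemma Phi_log_concave (x : R) :
  0 < x -> log_concave_on (fun nu => -1 < nu) (fun nu => Phi nu x).
Proof.
  intros Hx. apply log_concave_of_midpoint.
  - intros nu Hnu. now apply Phi_gt0.
  - intros a b Ha Hb.
    rewrite (Phi_mul x a b ((a + b) / 2)) by lra.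
    rewrite (Phi_bessel_pair ((a + b) / 2)) by exact Hx.
    rewrite (Rpow_mult_distr _ (bessel_pair _ _)).
    apply Rmult_le_compat_l; [apply pow2_ge_0|].
    apply bessel_pair_midpoint; lra.
  - intros a b Ha Hb.
    set (p := Rmin a b). set (q := Rmax a b).
    assert (Hp : -1 < p) by now apply Rmin_glb_lt.
    assert (Hpq : p <= q) by (apply Rle_trans with a; [apply Rmin_l|apply Rmax_l]).
    pose proof (Gamma_pos_gt0 (p + 1) ltac:(lra)). pose proof (Gamma_pos_gt0 (q + 1) ltac:(lra)).
    (* [2^(-c)] is smallest at [c = q], and the leading term [1 / Gamma (c + 1)] of the series is
       bounded below by [Gamma_pos_le_sum]. *)
    exists (exp (- x) * Rpower 2 (- q) * / (Gamma_pos (p + 1) + Gamma_pos (q + 1))).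
    split.
    + apply Rmult_lt_0_compat; [apply Rmult_lt_0_compat; apply exp_pos|].
      apply Rinv_0_lt_compat. lra.
    + intros c Hc. rewrite Phi_bessel_pair by exact Hx.
      apply Rmult_le_compat.
      * left. apply Rmult_lt_0_compat; apply exp_pos.
      * left. apply Rinv_0_lt_compat. lra.
      * apply Rmult_le_compat_l; [left; apply exp_pos|]. apply Rle_Rpower; lra.
      * apply Rle_trans with (2 := bessel_pair_ge (x / 2) c ltac:(lra) ltac:(lra)).
        rewrite rgamma_pos_arg by lra.
        apply Rinv_le_contravar; [apply Gamma_pos_gt0; lra|].
        apply Gamma_pos_le_sum; lra.
Qed.

Lemma Psi_log_convex (x : R) :
  0 < x -> log_convex_on (fun nu => - / 2 < nu) (fun nu => Psi nu x).
Proof.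
  intros Hx. destruct (log_convex_cm_Psi x Hx) as [Hcm Hmid].
  apply log_convex_of_midpoint.
  - intros nu Hnu. now apply Psi_gt0.
  - exact Hmid.
  (* Complete monotonicity makes [Psi] decreasing, so its left endpoint value is the local upper
     bound. *)
  - intros a b Ha Hb. exists (Psi (Rmin a b) x). intros c Hc.
    apply (completely_monotone_decr (- / 2) (fun nu => Psi nu x)); [exact Hcm| |apply Hc].
    now apply Rmin_glb_lt.
Qed.

Lemma Phi_turan_lower (nu x : R) :
  0 < x -> -1 < nu -> 0 < Phi nu x ^ 2 - Phi (nu - 1) x * Phi (nu + 1) x.
Proof.
  intros Hx Hnu.
  rewrite (Phi_mul x (nu - 1) (nu + 1) nu) by lra.
  rewrite Phi_bessel_pair by exact Hx.
  rewrite (Rpow_mult_distr _ (bessel_pair _ _)), <- Rmult_minus_distr_l.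
  apply Rmult_lt_0_compat.
  - apply pow_lt, Rmult_lt_0_compat; apply exp_pos.
  - pose proof (bessel_pair_turan (x / 2) nu ltac:(lra) Hnu). lra.
Qed.

(** The constant comes from the Gamma factors of [Psi]: [Gamma(nu+1/2)^2 / (Gamma(nu-1/2)
    Gamma(nu+3/2))] equals [(nu-1/2) / (nu+1/2) = 1 - 1/(nu+1/2)]. *)
Lemma Phi_turan_upper (nu x : R) :
  0 < x -> / 2 < nu ->
  Phi nu x ^ 2 - Phi (nu - 1) x * Phi (nu + 1) x <= / (nu + / 2) * Phi nu x ^ 2.
Proof.
  intros Hx Hnu.
  pose proof (proj2 (log_convex_cm_Psi x Hx) (nu - 1) (nu + 1) ltac:(lra) ltac:(lra)) as H.
  simpl in H. replace ((nu - 1 + (nu + 1)) / 2) with nu in H by field.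
  unfold Psi in H.
  set (g := Gamma_pos (nu - / 2)).
  assert (Hg : 0 < g) by (apply Gamma_pos_gt0; lra).
  assert (E0 : Gamma_pos (nu + / 2) = (nu - / 2) * g).
  { unfold g. rewrite <- Gamma_pos_succ by lra. f_equal. lra. }
  assert (E1 : Gamma_pos (nu + 1 + / 2) = (nu + / 2) * ((nu - / 2) * g)).
  { rewrite <- E0, <- Gamma_pos_succ by lra. f_equal. lra. }
  replace (nu - 1 + / 2) with (nu - / 2) in H by lra. fold g in H.
  rewrite E0, E1 in H.
  assert (Hs : 0 < sqrt PI) by (apply sqrt_lt_R0, PI_RGT_0).
  set (t := Rpower 2 nu) in *. assert (Ht : 0 < t) by apply exp_pos.
  assert (E2 : Rpower 2 (nu - 1) * Rpower 2 (nu + 1) = t * t).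
  { unfold t. rewrite <- !Rpower_plus. f_equal. ring. }
  set (p := Phi nu x) in *. set (pm := Phi (nu - 1) x) in *. set (pp := Phi (nu + 1) x) in *.
  set (K := (sqrt PI * t * g) ^ 2 * (nu - / 2)).
  assert (HK : 0 < K).
  { apply Rmult_lt_0_compat; [|lra]. apply pow_lt. now repeat apply Rmult_lt_0_compat. }
  assert (H2 : (nu - / 2) * p ^ 2 <= (nu + / 2) * (pm * pp)).
  { apply Rmult_le_reg_l with K; [exact HK|].
    replace (K * ((nu - / 2) * p ^ 2)) with
      (sqrt PI * t * ((nu - / 2) * g) * p * (sqrt PI * t * ((nu - / 2) * g) * p * 1))
      by (unfold K; ring).
    apply Rle_trans with (1 := H). right.
    transitivity (sqrt PI ^ 2 * (Rpower 2 (nu - 1) * Rpower 2 (nu + 1)) * g ^ 2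
                  * (nu - / 2) * ((nu + / 2) * (pm * pp))); [ring|].
    rewrite E2. unfold K. ring. }
  apply Rmult_le_reg_l with (nu + / 2); [lra|].
  rewrite <- Rmult_assoc, Rinv_r by lra. lra.
Qed.

Theorem theorem2 :
  forall x : R, 0 < x ->
    log_concave_on (fun nu => -1 < nu) (fun nu => Phi nu x) /\
    completely_monotonic_on (fun nu => - / 2 < nu) (fun nu => Psi nu x) /\
    log_convex_on (fun nu => - / 2 < nu) (fun nu => Psi nu x) /\
    (forall nu : R, / 2 < nu ->
       0 < (Phi nu x) ^ 2 - Phi (nu - 1) x * Phi (nu + 1) x /\
       (Phi nu x) ^ 2 - Phi (nu - 1) x * Phi (nu + 1) x
         <= / (nu + / 2) * (Phi nu x) ^ 2) /\
    (forall nu : R, -1 < nu ->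
       0 < (Phi nu x) ^ 2 - Phi (nu - 1) x * Phi (nu + 1) x).
Proof.
  intros x Hx. split; [now apply Phi_log_concave|].
  split; [apply completely_monotonic_on_intro, log_convex_cm_Psi, Hx|].
  split; [now apply Psi_log_convex|]. split.
  - intros nu Hnu. split; [apply Phi_turan_lower; lra|now apply Phi_turan_upper].
  - intros nu Hnu. now apply Phi_turan_lower.
Qed.
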